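(* Let $\alpha\in(0,1]$, let $\mathbf{X}$ be an $\alpha$-branched rough path on $[0,T]$ over $\mathbb{R}^d$, let $p\ge\lfloor 1/\alpha\rfloor$ be an integer, and let $f=(f_1,\ldots,f_d)$ be $p$-times continuously differentiable vector fields on $\mathbb{R}^m$. Let $y:[t_0,T]\to\mathbb{R}^m$, $0\le t_0<T$, be a solution of the rough differential equation $dy(t)=f(y(t))\,d\mathbf{X}(t)$, $y(t_0)=y_0\in\mathbb{R}^m$. Then, for $h>0$ (as $h\to 0$), $$y(t_0+h)=y_0+\sum_{\tau\in\mathcal{T}_p}\frac{1}{\sigma(\tau)}F(\tau)(y_0)\,\langle\mathbf{X}_{t_0,t_0+h},\tau\rangle+\mathcal{O}\big(h^{(p+1)\alpha}\big).$$
   Context: **Trees.** $\mathcal{T}$ is the set of nonempty rooted (non-planar) trees with vertices labeled by $\{1,\ldots,d\}$; $1$ denotes the empty tree, $\mathcal{T}^0=\mathcal{T}\cup\{1\}$. $[\tau_1\cdots\tau_n]_i$ is the tree obtained by attaching $\tau_1,\ldots,\tau_n$ to a new root labeled $i$ (order of branches irrelevant); $\bullet_i=[1]_i$. $|\tau|$ is the number of vertices; $\mathcal{T}_p=\{\tau\in\mathcal{T}:|\tau|\le p\}$. $\mathcal{F}$ is the set of unordered nonempty forests $\tau_1\cdots\tau_n$ with $\tau_j\in\mathcal{T}$, $|\tau_1\cdots\tau_n|=\sum_j|\tau_j|$, $\mathcal{F}^0=\mathcal{F}\cup\{1\}$; $\mathcal{F}_k$, $\mathcal{F}^0_k$ are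 the subsets of elements with $|\cdot|\le k$. For a forest $\mathfrak{h}=\tau_1\cdots\tau_n$, $[\mathfrak{h}]_i:=[\tau_1\cdots\tau_n]_i$. **Symmetry factor.** $\sigma(1)=\sigma(\bullet_i)=1$ and $\sigma(\tau)=r_1!\cdots r_q!\prod_{j=1}^k\sigma(\tau_j)$ for $\tau=[\tau_1\cdots\tau_k]_i=[(\tau_1)^{r_1}\cdots(\tau_q)^{r_q}]_i$, where on the right the $q$ distinct branches occur with multiplicities $r_1,\ldots,r_q$. **Elementary differentials.** $F(1)(y)=y$, $F(\bullet_i)(y)=f_i(y)$, and $F([\tau_1\cdots\tau_n]_i)(y)=f_i^{(n)}(y)(F(\tau_1)(y),\ldots,F(\tau_n)(y))$, $f_i^{(n)}$ being the $n$-th total derivative. **Hopf algebra.** $\mathcal{H}$ is the real vector space spanned by $\mathcal{F}^0$, with the commutative product of forests and unit $1$ (Connes–Kreimer Hopf algebra). The coproduct $\Delta:\mathcal{H}\to\mathcal{H}\otimes\mathcal{H}$ is the linear multiplicative map with $\Delta 1=1\otimes1$ and $\Delta[\tau_1\cdots\tau_n]_i=[\tau_1\cdots\tau_n]_i\otimes1+(\mathrm{id}\otimes B^i_+)(\Delta\tau_1\cdots\Delta\tau_n)$, $B^i_+(\mathfrak{h})=[\mathfrak{h}]_i$. On the dual $\mathcal{H}^*$ the product $\star$ is $\langle a\star b,\mathfrak{h}\rangle=\langle a\otimes b,\Delta\mathfrak{h}\rangle$. A forest is also viewed as an element of the dual via the dual basis. $\mathcal{H}_k$ is the span of $\mathcal{F}^0_k$.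 **Branched rough path.** An $\alpha$-branched rough path is a map $\mathbf{X}:[0,T]\times[0,T]\to\mathcal{H}^*$ such that (1) $\langle\mathbf{X}_{s,t},\mathfrak{h}_1\rangle\langle\mathbf{X}_{s,t},\mathfrak{h}_2\rangle=\langle\mathbf{X}_{s,t},\mathfrak{h}_1\cdot\mathfrak{h}_2\rangle$ for all $\mathfrak{h}_1,\mathfrak{h}_2\in\mathcal{H}$; (2) $\mathbf{X}_{s,t}=\mathbf{X}_{s,u}\star\mathbf{X}_{u,t}$ for all $s,u,t$; (3) $\sup_{s\ne t}|\langle\mathbf{X}_{s,t},\tau\rangle|/|t-s|^{\alpha|\tau|}<\infty$ for every $\tau\in\mathcal{T}$. **Controlled paths and integral.** Put $N=\lfloor1/\alpha\rfloor$. A path $\mathbf{Z}:[0,T]\to(\mathcal{H}_{N-1})^m$ is controlled by $\mathbf{X}$ if for each $\mathfrak{h}\in\mathcal{F}^0_{N-1}$, $\langle\mathfrak{h},\mathbf{Z}(t)\rangle=\langle\mathbf{X}_{s,t}\star\mathfrak{h},\mathbf{Z}(s)\rangle+R^{\mathfrak{h}}_{s,t}$ with $|R^{\mathfrak{h}}_{s,t}|\le C|t-s|^{(N-|\mathfrak{h}|)\alpha}$; it is a controlled path above $Z(t)=\langle1,\mathbf{Z}(t)\rangle$. Its integral is $\int_s^tZ(r)\,d\mathbf{X}^i(r)=\lim_{|\mathcal{P}|\to0}\sum_{[u,v]\in\mathcal{P}}\sum_{\mathfrak{h}\in\mathcal{F}^0_{N-1}}\langle\mathfrak{h},\mathbf{Z}(u)\rangle\langle\mathbf{X}_{u,v},[\mathfrak{h}]_i\rangle$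 over partitions $\mathcal{P}$ of $[s,t]$ (the limit exists). For smooth $\phi:\mathbb{R}^m\to\mathbb{R}^m$, $\phi(\mathbf{Z})$ is the controlled path with $\langle1,\phi(\mathbf{Z}(t))\rangle=\phi(Z(t))$ and, for $\mathfrak{h}\in\mathcal{F}_{N-1}$, $\langle\mathfrak{h},\phi(\mathbf{Z}(t))\rangle=\sum_{n=1}^{N-1}\sum_{\mathfrak{h}_1\cdots\mathfrak{h}_n=\mathfrak{h}}\frac1{n!}\phi^{(n)}(Z(t))(\langle\mathfrak{h}_1,\mathbf{Z}(t)\rangle,\ldots,\langle\mathfrak{h}_n,\mathbf{Z}(t)\rangle)$, the inner sum being over ordered $n$-tuples of nonempty forests. **Solution.** $y$ is a solution of $dy=f(y)\,d\mathbf{X}$, $y(t_0)=y_0$, if there is a controlled path $\mathbf{Y}$ above $y$ (on $[t_0,T]$) with $y(t)-y(s)=\sum_{i=1}^d\int_s^tf_i(y(r))\,d\mathbf{X}^i(r)$ for $t_0\le s\le t\le T$ (integrals of the controlled paths $f_i(\mathbf{Y})$), and whose higher coefficients are those of the integral: $\langle[\tau_1\cdots\tau_n]_i,\mathbf{Y}(t)\rangle=\langle\tau_1\cdots\tau_n,f_i(\mathbf{Y}(t))\rangle$ for every tree $[\tau_1\cdots\tau_n]_i\in\mathcal{T}_{N-1}$, and $\langle\mathfrak{h},\mathbf{Y}(t)\rangle=0$ for $\mathfrak{h}\in\mathcal{F}_{N-1}\setminus\mathcal{T}_{N-1}$. *)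

(* Defs.v *)
From HB Require Import structures.
From mathcomp Require Import all_boot all_order all_algebra.
From mathcomp Require Import finmap multiset.
From mathcomp Require Import all_classical all_reals all_analysis.

Set Implicit Arguments.
Unset Strict Implicit.
Unset Printing Implicit Defensive.

Import Order.TTheory GRing.Theory Num.Theory.
Import numFieldNormedType.Exports.

Local Open Scope classical_set_scope.
Local Open Scope ring_scope.

(* Non-planar labelled rooted trees are represented by planar ones whose
   branches are recursively sorted: [ptree] is the planar type, [pnf] sorts the
   branches at every vertex, and [tree] is the subtype of fixed points of [pnf],
   one for each class of planar trees modulo reordering of branches. By
   [tree_root_bplus], [tree_branches_bplus] and [bplus_tree_branches] below,
   [bplus : 'I_d -> {mset tree d} -> tree d] is a bijection from pairs. *)

Inductive ptree (d : nat) : Type := PNode of 'I_d & seq (ptree d).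

Section PTree.
Variable d : nat.
Implicit Types (t u : ptree d) (ts : seq (ptree d)).

Lemma ptree_nested_ind (P : ptree d -> Prop) :
  (forall i ts, foldr (fun u Q => P u /\ Q) True ts -> P (PNode i ts)) ->
  forall t, P t.
Proof.
move=> H; fix IH 1 => -[i ts]; apply: H.
by elim: ts => [|t ts IHs] /=; [exact: I | split; [exact: IH | exact: IHs]].
Qed.

Fixpoint ptree_enc t : GenTree.tree 'I_d :=
  let: PNode i ts := t in
  GenTree.Node 0 (GenTree.Leaf i :: [seq ptree_enc u | u <- ts]).

Fixpoint ptree_dec (g : GenTree.tree 'I_d) : option (ptree d) :=
  if g is GenTree.Node _ (GenTree.Leaf i :: gs)
  then Some (PNode i (pmap id [seq ptree_dec g' | g' <- gs])) else None.

Lemma ptree_encK : pcancel ptree_enc ptree_dec.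
Proof.
elim/ptree_nested_ind => i ts IH /=; congr (Some (PNode i _)).
elim: ts IH => //= t ts IHs [-> /IHs] /= E.
by rewrite E.
Qed.

HB.instance Definition _ := Countable.copy (ptree d) (pcan_type ptree_encK).

Lemma ptree_mem_ind (P : ptree d -> Prop) :
  (forall i ts, (forall u, u \in ts -> P u) -> P (PNode i ts)) ->
  forall t, P t.
Proof.
move=> H; elim/ptree_nested_ind => i ts IH; apply: H.
elim: ts IH => //= t ts IHs [Pt /IHs Pts] u.
by rewrite inE => /predU1P[-> // | /Pts].
Qed.

Definition ple : rel (ptree d) := fun t u =>
  (choice.pickle t <= choice.pickle u)%N.

Lemma ple_total : total ple. Proof. by move=> t u; apply: leq_total. Qed.
Lemma ple_trans : transitive ple. Proof. by move=> t u v; apply: leq_trans. Qed.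
Lemma ple_anti : antisymmetric ple.
Proof. by move=> t u /anti_leq /(pcan_inj choice.pickleK). Qed.

Fixpoint pnf t : ptree d :=
  let: PNode i ts := t in PNode i (sort ple [seq pnf u | u <- ts]).

Lemma pnf_idem t : pnf (pnf t) = pnf t.
Proof.
elim/ptree_mem_ind: t => i ts IH /=; congr PNode.
rewrite map_id_in; last first.
  by move=> u; rewrite mem_sort => /mapP[v vts ->]; apply: IH.
by rewrite (sorted_sort ple_trans) // sort_sorted //; exact: ple_total.
Qed.

Fixpoint psize t : nat :=
  let: PNode _ ts := t in (sumn [seq psize u | u <- ts]).+1.

End PTree.

Record tree (d : nat) := Tree { pval : ptree d; _ : pnf pval == pval }.

HB.instance Definition _ (d : nat) := [isSub for @pval d].
HB.instance Definition _ (d : nat) := [Countable of tree d by <:].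

Notation forest d := {mset (tree d)}%mset.

Section Trees.
Variable d : nat.
Implicit Types (t : tree d) (g h : forest d).

Definition mktree (u : ptree d) : tree d :=
  Tree (introT eqP (pnf_idem u)).

Definition bplus (i : 'I_d) h : tree d :=
  mktree (PNode i [seq pval t | t <- (h : seq (tree d))]).

Definition tree_root t : 'I_d := let: PNode i _ := pval t in i.

Definition tree_branches t : forest d :=
  let: PNode _ us := pval t in seq_mset [seq mktree u | u <- us].

Definition unit_forest : forest d := mset0.

Definition tree_forest t : forest d := msetn 1 t.

Definition tree_size t : nat := psize (pval t).

Definition forest_size h : nat :=
  (\sum_(t <- (h : seq (tree d))) tree_size t)%N.

(* For [u = pval t], isomorphic branches are equal as planar trees. *)
Fixpoint psymfactor (u : ptree d) : nat :=
  let: PNode _ us := u in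
  ((\prod_(v <- undup us) (count_mem v us)`!) *
   \prod_(k <- [seq psymfactor v | v <- us]) k)%N.

Definition symfactor t : nat := psymfactor (pval t).

(* The coproduct of a forest is a combination, with coefficients in nat, of
   pure tensors of forests. It is represented by the list of these pure tensors
   (with repetitions); [cop_mul] is the product of H (x) H on such lists. *)
Definition cop_mul (A B : seq (forest d * forest d)) :
    seq (forest d * forest d) :=
  [seq (msetD a.1 b.1, msetD a.2 b.2) | a <- A, b <- B].

Definition cop_prod (As : seq (seq (forest d * forest d))) :=
  foldr cop_mul [:: (unit_forest, unit_forest)] As.

Fixpoint pcop (u : ptree d) : seq (forest d * forest d) :=
  let: PNode i us := u in
  (tree_forest (mktree u), unit_forest) ::
  [seq (a.1, tree_forest (bplus i a.2)) |
     a <- cop_prod [seq pcop v | v <- us]].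

Definition cop_tree t : seq (forest d * forest d) := pcop (pval t).

Definition cop h : seq (forest d * forest d) :=
  cop_prod [seq cop_tree t | t <- (h : seq (tree d))].

Lemma pval_inj : injective (@pval d). Proof. exact: val_inj. Qed.

Lemma mktree_pval t : mktree (pval t) = t.
Proof. by apply: pval_inj; apply/eqP; case: t. Qed.

Lemma pnf_pval t : pnf (pval t) = pval t. Proof. by apply/eqP; case: t. Qed.

Lemma pval_bplus i h :
  pval (bplus i h) =
  PNode i (sort (@ple d) [seq pval t | t <- (h : seq (tree d))]).
Proof.
rewrite /=; congr (PNode _ (sort _ _)).
by rewrite -map_comp; apply: eq_map => t /=; rewrite pnf_pval.
Qed.

Lemma tree_root_bplus i h : tree_root (bplus i h) = i.
Proof. by rewrite /tree_root pval_bplus. Qed.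

Lemma tree_branches_bplus i h : tree_branches (bplus i h) = h.
Proof.
rewrite /tree_branches pval_bplus -[RHS]seq_mset_id; apply/eq_seq_msetP.
apply: perm_trans (perm_map _ (permEl (perm_sort _ _))) _.
by rewrite -map_comp (eq_map (g := id)) ?map_id // => t /=; rewrite mktree_pval.
Qed.

Lemma bplus_tree_branches t : bplus (tree_root t) (tree_branches t) = t.
Proof.
apply: pval_inj; rewrite pval_bplus /tree_root /tree_branches.
case: t => -[i us] /= /eqP[E]; congr PNode.
have us_nf u : u \in us -> pnf u = u.
  by rewrite -E mem_sort => /mapP[v _ ->]; apply: pnf_idem.
have us_sorted : sorted (@ple d) us.
  by rewrite -E; apply: sort_sorted; apply: ple_total.
rewrite -[RHS](sorted_sort (@ple_trans d) us_sorted).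
apply/perm_sortP; [exact: ple_total | exact: ple_trans | exact: ple_anti |].
apply: perm_trans (perm_map _ (perm_eq_seq_mset _)) _.
by rewrite -map_comp map_id_in // => u /us_nf.
Qed.

Lemma tree_size_bplus i h : tree_size (bplus i h) = (forest_size h).+1.
Proof.
rewrite /tree_size pval_bplus /=; congr _.+1; rewrite /forest_size sumn_map.
rewrite (perm_big _ (permEl (perm_sort _ _))) /= big_map.
by apply: eq_bigr.
Qed.

Lemma symfactor_bplus i h :
  symfactor (bplus i h) =
  ((\prod_(t <- undup (h : seq (tree d))) (h t)`!) *
   \prod_(t <- (h : seq (tree d))) symfactor t)%N.
Proof.
rewrite /symfactor pval_bplus /=; set us := map _ _.
have pus : perm_eq (sort (@ple d) us) us by exact: permEl (perm_sort _ _).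
congr (_ * _)%N; last first.
  by rewrite big_map (perm_big _ pus) /= big_map.
rewrite (perm_big (undup us)) /=; last exact: perm_undup (perm_mem pus).
rewrite /us undup_map_inj ?big_map; last exact: pval_inj.
apply: eq_bigr => t _; rewrite (permP pus) count_map -count_mem_mset.
by congr (_`!); apply: eq_count => u /=; rewrite (inj_eq pval_inj).
Qed.

Lemma perm_cop_mul A A' B B' : perm_eq A A' -> perm_eq B B' ->
  perm_eq (cop_mul A B) (cop_mul A' B').
Proof. by move=> pA pB; apply: perm_allpairs. Qed.

Lemma perm_cop_mulCA (A B C : seq (forest d * forest d)) :
  perm_eq (cop_mul A (cop_mul B C)) (cop_mul B (cop_mul A C)).
Proof.
apply/permP => P; rewrite -!sum1_count [LHS]big_mkcond [RHS]big_mkcond /=.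
rewrite !big_allpairs_dep /=.
under eq_bigr do rewrite big_allpairs_dep.
under [RHS]eq_bigr do rewrite big_allpairs_dep.
rewrite exchange_big /=.
apply: eq_bigr => b _; apply: eq_bigr => a _; apply: eq_bigr => c _.
by rewrite msetDCA [X in (_, X)]msetDCA.
Qed.

Lemma perm_cop_prod (As Bs : seq (seq (forest d * forest d))) :
  perm_eq As Bs -> perm_eq (cop_prod As) (cop_prod Bs).
Proof.
elim: As Bs => [|A As IH] Bs pAB.
  by move: pAB; rewrite perm_sym => /perm_nilP ->.
have /path.splitPr : A \in Bs by rewrite -(perm_mem pAB) mem_head.
move=> E; case: E pAB => B1 B2 pAB.
have {IH}pA : perm_eq (cop_prod As) (cop_prod (B1 ++ B2)).
  apply: IH; rewrite -(perm_cons A); apply: perm_trans pAB _.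
  exact: (permEl (perm_catCA B1 [:: A] B2)).
apply: perm_trans (perm_cop_mul (perm_refl A) pA) _.
elim: B1 {pAB pA} => //= B B1 IH.
apply: perm_trans (perm_cop_mulCA _ _ _) _.
exact: perm_cop_mul.
Qed.

Lemma cop_tree_bplus i h :
  perm_eq (cop_tree (bplus i h))
    ((tree_forest (bplus i h), unit_forest) ::
     [seq (a.1, tree_forest (bplus i a.2)) | a <- cop h]).
Proof.
rewrite /cop_tree {1}pval_bplus /= -pval_bplus mktree_pval perm_cons.
apply/perm_map/perm_cop_prod; rewrite /cop.
apply: perm_trans (perm_map _ (permEl (perm_sort _ _))) _.
by rewrite -map_comp.
Qed.

(* [\sum_(x \in A) F x] is 0 when F has infinite support in A. The index sets
   used below are finite, see [finite_tree_le], [finite_forest_le] and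
   [finite_forest_decomp]. *)

Lemma finite_seq_upto (T : choiceType) (A : set T) (n : nat) : finite_set A ->
  finite_set [set s : seq T | (size s <= n)%N /\ forall x, x \in s -> A x].
Proof.
move=> finA; elim: n => [|n IH].
  apply: (sub_finite_set (B := [set [::]])); last exact: finite_set1.
  by move=> [|x s] [].
apply: (sub_finite_set (B := [set [::]] `|`
   [set x.1 :: x.2 | x in A `*`
     [set s : seq T | (size s <= n)%N /\ forall x, x \in s -> A x]])).
  move=> [|x s] [/= sn sA]; [by left | right].
  exists (x, s) => //; split => /=; first by apply: sA; rewrite mem_head.
  by split => // z zs; apply: sA; rewrite inE zs orbT.
rewrite finite_setU; split; first exact: finite_set1.
exact/finite_image/finite_setX.
Qed.

Lemma forest_size_ge h : (size (h : seq (tree d)) <= forest_size h)%N.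
Proof.
rewrite /forest_size -sum1_size; apply: leq_sum => -[[i us] ?] _.
by rewrite /tree_size.
Qed.

Lemma forest_size_mem h t : t \in h -> (tree_size t <= forest_size h)%N.
Proof. by move=> th; rewrite /forest_size (big_rem t) //= leq_addr. Qed.

Lemma finite_tree_le_forest n : finite_set [set t | (tree_size t <= n)%N] ->
  finite_set [set h | (forest_size h <= n)%N].
Proof.
move=> /(@finite_seq_upto (tree d) _ n) /(finite_image (@seq_mset (tree d))).
apply: sub_finite_set => h /= hn; exists (h : seq (tree d)).
  split; first exact: leq_trans (forest_size_ge h) hn.
  by move=> t /forest_size_mem /leq_trans; apply.
exact: seq_mset_id.
Qed.

Lemma finite_tree_le n : finite_set [set t | (tree_size t <= n)%N].
Proof.
elim: n => [|n /finite_tree_le_forest IH].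
  apply: (sub_finite_set (B := set0)) => // -[[i us] ?].
  by rewrite /tree_size.
have : finite_set [set bplus x.1 x.2 | x in
    [set: 'I_d] `*` [set h | (forest_size h <= n)%N]].
  by apply: finite_image; apply: finite_setX => //; apply: finite_finset.
apply: sub_finite_set => t /= tn; exists (tree_root t, tree_branches t).
  split => //=.
  by rewrite -ltnS -(tree_size_bplus (tree_root t)) bplus_tree_branches.
exact: bplus_tree_branches.
Qed.

Lemma finite_forest_le n : finite_set [set h | (forest_size h <= n)%N].
Proof. exact/finite_tree_le_forest/finite_tree_le. Qed.

Lemma forest_sizeD g h :
  forest_size (msetD g h) = (forest_size g + forest_size h)%N.
Proof.
have pgh : perm_eq (msetD g h : seq (tree d))
    ((g : seq (tree d)) ++ (h : seq (tree d))).
  by apply/allP => t _ /=; rewrite count_cat !count_mem_mset msetE2.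
by rewrite /forest_size (perm_big _ pgh) big_cat.
Qed.

Lemma finite_forest_decomp n h :
  finite_set [set hs : n.-tuple (forest d) |
    unit_forest \notin (hs : seq (forest d)) /\
    \big[@msetD _/unit_forest]_(g <- hs) g = h].
Proof.
have := @finite_seq_upto _ _ n (finite_forest_le (forest_size h)).
move=> /(finite_preimage (f := @tval n (forest d))) H.
apply: sub_finite_set (H _); last by move=> ? ? _ _; apply: val_inj.
move=> hs [_ <-] /=; split; first by rewrite size_tuple.
move=> g; elim: (tval hs) => //= g' s IH.
rewrite inE big_cons forest_sizeD => /predU1P[->|/IH]; first exact: leq_addr.
by move=> /leq_trans; apply; apply: leq_addl.
Qed.

End Trees.

Section RoughPaths.
Variables (R : realType) (d m : nat).
Local Notation V := 'rV[R]_m.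
Implicit Types (h g : forest d) (Z : forest d -> V) (phi : V -> V).

(* [totderiv phi [:: v1; ...; vn] y] is the n-th total derivative
   phi^(n)(y)(v1, ..., vn): the differential at y, in the direction v1, of
   y |-> phi^(n-1)(y)(v2, ..., vn). *)
Fixpoint totderiv phi (vs : seq V) : V -> V :=
  if vs is v :: vs' then fun y => 'd (totderiv phi vs') y v else phi.

(* A map into the finite-dimensional space of (multi)linear maps is
   differentiable, or continuous, iff all its evaluations are. *)
Definition cont_diff (p : nat) phi : Prop :=
  (forall vs, (size vs < p)%N ->
     forall y, differentiable (totderiv phi vs) y) /\
  (forall vs, (size vs <= p)%N -> continuous (totderiv phi vs)).

Fixpoint pelemdiff (f : 'I_d -> V -> V) (u : ptree d) : V -> V :=
  let: PNode i us := u in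
  fun y => totderiv (f i) [seq pelemdiff f v y | v <- us] y.

Definition elemdiff (f : 'I_d -> V -> V) (t : tree d) : V -> V :=
  pelemdiff f (pval t).

(* The dual of H: since H is the free vector space on forests, a linear
   functional on H is a function on forests. The product of H is the bilinear
   extension of [msetD], so multiplicativity is required on forests only. *)
Definition hdual := forest d -> R.

Implicit Types a b : hdual.

Definition hstar a b : hdual := fun h => \sum_(p <- cop h) a p.1 * b p.2.

Definition dual_forest h : hdual := fun g => (g == h)%:R.

Definition branched_rough_path (alpha T : R) (X : R -> R -> hdual) : Prop :=
  [/\ forall s t, s \in `[0, T] -> t \in `[0, T] ->
        forall h1 h2, X s t h1 * X s t h2 = X s t (msetD h1 h2),
      forall s u t, s \in `[0, T] -> u \in `[0, T] -> t \in `[0, T] ->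
        X s t = hstar (X s u) (X u t) &
      forall tau : tree d, exists C : R, forall s t,
        s \in `[0, T] -> t \in `[0, T] -> s != t ->
        `|X s t (tree_forest tau)| / `|t - s| `^ (alpha * (tree_size tau)%:R)
          <= C].

(* The integer part of 1 / alpha ([Num.truncn] agrees with the floor on
   nonnegative reals). *)
Definition level (alpha : R) : nat := Num.truncn alpha^-1.

(* An element of (H_k)^m is given by its m-tuple of coefficients on each
   forest, zero on forests with more than k vertices. *)
Definition in_span (k : nat) Z : Prop :=
  forall h, (k < forest_size h)%N -> Z h = 0.

Definition pairing (k : nat) a Z : V :=
  \sum_(g \in [set g : forest d | (forest_size g <= k)%N]) a g *: Z g.

Definition controlled (alpha : R) (X : R -> R -> hdual) (t0 T : R)
    (Z : R -> forest d -> V) : Prop :=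
  (forall t, t \in `[t0, T] -> in_span (level alpha).-1 (Z t)) /\
  forall h, (forest_size h <= (level alpha).-1)%N ->
    exists C : R, forall s t, s \in `[t0, T] -> t \in `[t0, T] ->
      `|Z t h - pairing (level alpha).-1 (hstar (X s t) (dual_forest h)) (Z s)|
        <= C * `|t - s| `^ ((level alpha - forest_size h)%N%:R * alpha).

Definition riemann_sum (alpha : R) (X : R -> R -> hdual) (i : 'I_d)
    (Z : R -> forest d -> V) (s : R) (P : seq R) : V :=
  \sum_(uv <- zip (s :: P) P)
    \sum_(h \in [set h : forest d | (forest_size h <= (level alpha).-1)%N])
      X uv.1 uv.2 (tree_forest (bplus i h)) *: Z uv.1 h.

(* [I] is the integral of [Z] against X^i over [s, t]. A partition
   s = x0 < x1 < ... < xn = t is given by the list [:: x1; ...; xn]. *)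
Definition is_rough_integral (alpha : R) (X : R -> R -> hdual) (i : 'I_d)
    (Z : R -> forest d -> V) (s t : R) (I : V) : Prop :=
  forall eps : R, 0 < eps -> exists2 delta : R, 0 < delta &
    forall P : seq R, itv_partition s t P ->
      (forall uv, uv \in zip (s :: P) P -> uv.2 - uv.1 < delta) ->
      `|riemann_sum alpha X i Z s P - I| < eps.

Definition comp_controlled (alpha : R) phi Z : forest d -> V := fun h =>
  if h == unit_forest d then phi (Z (unit_forest d))
  else if (forest_size h <= (level alpha).-1)%N then
    \sum_(1 <= n < level alpha)
      \sum_(hs \in [set hs : n.-tuple (forest d) |
                     unit_forest d \notin (hs : seq (forest d)) /\
                     \big[@msetD _/unit_forest d]_(g <- hs) g = h])
        n`!%:R^-1 *: totderiv phi [seq Z g | g <- hs] (Z (unit_forest d))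
  else 0.

Definition rde_solution (alpha T : R) (X : R -> R -> hdual)
    (f : 'I_d -> V -> V) (t0 : R) (y0 : V) (y : R -> V) : Prop :=
  y t0 = y0 /\
  exists Y : R -> forest d -> V,
    [/\ controlled alpha X t0 T Y,
        forall t, t \in `[t0, T] -> Y t (unit_forest d) = y t,
        forall s t, t0 <= s -> s <= t -> t <= T ->
          exists2 I : 'I_d -> V,
            forall i, is_rough_integral alpha X i
              (fun r => comp_controlled alpha (f i) (Y r)) s t (I i) &
            y t - y s = \sum_(i < d) I i,
        forall t, t \in `[t0, T] -> forall i h,
          (tree_size (bplus i h) <= (level alpha).-1)%N ->
          Y t (tree_forest (bplus i h)) = comp_controlled alpha (f i) (Y t) h &
        forall t, t \in `[t0, T] -> forall h,
          (forest_size h <= (level alpha).-1)%N -> h != unit_forest d ->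
          (forall tau, h != tree_forest tau) -> Y t h = 0].

End RoughPaths.

(* Main.v *)
Require Import Defs.
From mathcomp Require Import all_boot all_order all_algebra.
From mathcomp Require Import finmap multiset.
From mathcomp Require Import all_classical all_reals all_analysis.
From mathcomp Require Import ring lra zify.

Set Implicit Arguments.
Unset Strict Implicit.
Unset Printing Implicit Defensive.

Import Order.TTheory GRing.Theory Num.Theory.
Import numFieldNormedType.Exports.

Local Open Scope classical_set_scope.
Local Open Scope ring_scope.

(* Write eps = |t - s|^alpha, N = floor(1/alpha) and
   Xi^q_{s,t} = sum_{|tau| <= q} F(tau)(y_s) / sigma(tau) <X_{s,t}, tau>.
   Chen's relation gives
   Xi^q_{s,t} - Xi^q_{s,u} - Xi^q_{u,t} =
     sum_{|tau| <= q} <X_{u,t}, tau> (c_tau - F(tau)(y_u) / sigma(tau)),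
   where c_tau = sum_{|tau'| <= q} F(tau')(y_s) / sigma(tau') <X_{s,u}, x>, summed
   over the terms x (x) tau of Delta tau'. If y_u - y_s = Xi^q_{s,u} + O(eps^q), then
   Taylor's formula for the derivatives of f and induction on tau show that
   F(tau)(y_u) / sigma(tau) = c_tau + O(eps^(q + 1 - |tau|)), so the increment above
   is O(eps^(q + 1)). For q >= N this exponent of |t - s| exceeds 1, and the sums of
   y_t - y_s - Xi^q_{s,t} over fine partitions tend to 0 because y is a rough
   integral; summing along dyadic partitions (the sewing argument) then yields
   y_t - y_s = Xi^q_{s,t} + O(eps^(q + 1)), the hypothesis of the next step.
   The expansion of the controlled path at the empty forest starts the induction
   at q = N, and q = p is the theorem. *)

(** * Total derivatives *)

Section LineCalculus.
Variables (R : realType) (m : nat).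
Local Notation V := 'rV[R]_m.
Implicit Types (phi : V -> V) (u v x y : V) (vs ws : seq V).

(** The coproduct meets Taylor's formula in an exponential identity. Pairing the first factor of
    Delta h with a character replaces each tree of the forest h, independently, by a scalar or by a
    combination of single trees. Summing a symmetric multilinear expression over all multisets h of
    n trees, weighted by the inverse factorials of the multiplicities (the part of sigma belonging
    to the root), collects these choices into one term: 1/j! times the expression with j arguments
    equal to Xi and one argument c_t for each tree t of the target forest g. These are the Taylor
    terms of f_i at y_s, and they explain the use of multisets and of symmetric multilinear maps
    throughout. Taylor's formula counts the trees of h, whereas c_tau is cut off by vertices. The
    two ranges differ by forests with at least q vertices, whose coefficients are small enough to be
    part of the error. The argument requires <X, 1> = 1. The axioms leave one other case, X = 0,
    where y is constant; it is treated apart. *)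

Lemma is_derive_line (W : normedModType R) (g : V -> W) x v (t : R) (D : W) :
  is_derive (x + t *: v) v g D -> is_derive t 1 (fun r : R => g (x + r *: v)) D.
Proof.
move=> [dg Dg].
have E : (fun h : R => h^-1 *: (((fun r : R => g (x + r *: v)) \o shift t) (h *: 1)
            - g (x + t *: v))) =
         (fun h : R => h^-1 *: ((g \o shift (x + t *: v)) (h *: v) - g (x + t *: v))).
  apply/funext => h /=; congr (_ *: (g _ - _)).
  by rewrite -[h *: 1]/(h * 1) mulr1 scalerDl addrCA.
by split; rewrite /derivable /derive E.
Qed.

Lemma is_derive_coord_line phi x v (t : R) (j : 'I_m) :
  differentiable phi (x + t *: v) ->
  is_derive t 1 (fun r : R => phi (x + r *: v) 0 j) ('d phi (x + t *: v) v 0 j).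
Proof.
move=> dphi; apply: (@is_derive_line _ (fun z => phi z 0 j)).
have dv : derivable phi (x + t *: v) v by exact: diff_derivable.
split.
  by have /derivable_mxP := dv; apply.
by rewrite -deriveE // derive_mx // mxE.
Qed.

Lemma mean_value (f df : R -> R) (a b : R) : a <= b ->
  (forall t, a <= t <= b -> is_derive t 1 f (df t)) ->
  exists2 c, a <= c <= b & f b - f a = df c * (b - a).
Proof.
move=> ab dfE; have [||c] := @MVT_segment _ f df a b ab.
- move=> t; rewrite in_itv /= => /andP[? ?].
  by apply: dfE; rewrite !ltW.
- apply: derivable_within_continuous => t; rewrite in_itv /= => /dfE h.
  exact: (@ex_derive _ _ _ _ _ _ _ h).
- by rewrite in_itv /= => ? ?; exists c.
Qed.

Lemma coord_norm_le (z : V) (j : 'I_m) : `|z 0 j| <= `|z|.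
Proof.
by rewrite {2}/Num.norm /= mx_normrE; apply: le_trans (le_bigmax _ _ (ord0, j)).
Qed.

Lemma rv_norm_le (z : V) (a : R) : 0 <= a -> (forall j, `|z 0 j| <= a) -> `|z| <= a.
Proof.
move=> a0 za; rewrite /Num.norm /= mx_normrE; apply/bigmax_leP; split => // -[i j] _ /=.
by rewrite ord1.
Qed.

(* Both mixed derivatives are limits of this second difference, whence their
   equality in [diff_swap]. *)
Lemma second_difference phi u v x (j : 'I_m) (h : R) :
  (forall vs, (size vs < 2)%N -> forall z, differentiable (totderiv phi vs) z) ->
  0 <= h ->
  exists2 ab : R * R, 0 <= ab.1 <= h /\ 0 <= ab.2 <= h &
    (phi (x + h *: v + h *: u) - phi (x + h *: u)
       - (phi (x + h *: v) - phi x)) 0 j =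
    totderiv phi [:: v; u] (x + ab.1 *: u + ab.2 *: v) 0 j * h * h.
Proof.
move=> dphi h0.
have d0 z : differentiable phi z by exact: (dphi [::]).
have d1 z : differentiable (totderiv phi [:: u]) z by exact: (dphi [:: u]).
(* The mean value theorem is used twice: along [u] for the difference across [h *: v], then along
   [v] for the derivative in direction [u]. *)
pose g r := phi (x + h *: v + r *: u) 0 j - phi (x + r *: u) 0 j.
have dg (t : R) : is_derive t 1 g
    ('d phi (x + h *: v + t *: u) u 0 j - 'd phi (x + t *: u) u 0 j).
  by apply: is_deriveB; apply: is_derive_coord_line.
have [a ah Ea] := mean_value h0 (fun t _ => dg t).
pose k r := totderiv phi [:: u] (x + a *: u + r *: v) 0 j.
have dk (t : R) : is_derive t 1 k (totderiv phi [:: v; u] (x + a *: u + t *: v) 0 j).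
  exact: (is_derive_coord_line (phi := totderiv phi [:: u])).
have [b bh Eb] := mean_value h0 (fun t _ => dk t).
exists (a, b) => //=; rewrite !subr0 in Ea Eb.
transitivity ((k h - k 0) * h); last by rewrite Eb.
rewrite /k /= scale0r addr0 (addrAC x (a *: u)) -Ea /g.
by rewrite scale0r !addr0 !mxE.
Qed.

Lemma diff_swap phi u v : cont_diff 2 phi ->
  totderiv phi [:: u; v] = totderiv phi [:: v; u].
Proof.
move=> [dphi cphi]; apply/funext => x; apply/rowP => j.
have [F FE] : {F | F = fun w w' z => totderiv phi [:: w; w'] z 0 j} by eexists.
suff : F u v x = F v u x by rewrite FE.
apply/eqP; rewrite -subr_eq0 -normr_le0; apply/ler_addgt0Pr => e e0.
rewrite add0r.
have near_val w w' : \forall z \near x, `|F w w' x - F w w' z| < e / 2.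
  have := cphi [:: w; w'] isT x.
  have e20 : 0 < e / 2 by rewrite divr_gt0.
  move=> /cvgrPdist_lt /(_ _ e20); apply: filterS => z; apply: le_lt_trans.
  rewrite FE; apply: le_trans (coord_norm_le _ j).
  by rewrite !mxE.
have /nbhs_ballP[r /= r0 Hr] :=
  @filterI _ (nbhs x) (nbhs_filter x) _ _ (near_val u v) (near_val v u).
(* The summand 1 keeps [K] positive when both directions vanish. Then [h * K = r / 2], so all
   intermediate points stay in the ball. *)
pose K := `|u| + `|v| + 1.
have K0 : 0 < K by rewrite ltr_wpDl ?addr_ge0.
pose h := r / K / 2.
have h0 : 0 < h by rewrite !divr_gt0.
have in_ball (a b : R) : 0 <= a <= h -> 0 <= b <= h -> ball x r (x + a *: u + b *: v).
  move=> /andP[a0 ah] /andP[b0 bh].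
  rewrite -ball_normE /= -addrA opprD addNKr normrN.
  apply: le_lt_trans (ler_normD _ _) _; rewrite !normrZ !ger0_norm //.
  apply: (@le_lt_trans _ _ (h * K)).
    have ua : a * `|u| <= h * `|u| by apply: ler_wpM2r.
    have vb : b * `|v| <= h * `|v| by apply: ler_wpM2r.
    by rewrite /K; lra.
  by rewrite /h mulrAC divfK ?gt_eqF // ltr_pdivrMr // ltr_pMr // ltr1n.
have [[a b] /= [ah bh] E1] := second_difference u v x j dphi (ltW h0).
have [[b' a'] /= [bh' ah'] E2] := second_difference v u x j dphi (ltW h0).
(* The second difference is symmetric in [u] and [v], and [h] is nonzero, so the two mixed
   derivatives agree at their respective intermediate points. *)
have EE : F v u (x + a *: u + b *: v) = F u v (x + a' *: u + b' *: v).
  rewrite (addrAC x (a' *: u)).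
  apply: (mulIf (lt0r_neq0 h0)); apply: (mulIf (lt0r_neq0 h0)).
  rewrite FE -E1 -E2 (addrAC x); set A := phi (_ + _ + _).
  by rewrite !mxE; lra.
have [_ H1] := Hr _ (in_ball _ _ ah bh).
have [H2 _] := Hr _ (in_ball _ _ ah' bh'); rewrite -EE in H2.
rewrite (le_trans (ler_distD (F v u (x + a *: u + b *: v)) _ _)) // (splitr e).
by rewrite lerD // ltW // distrC.
Qed.
End LineCalculus.

Section TotalDerivatives.
Variables (R : realType) (m : nat).
Local Notation V := 'rV[R]_m.
Implicit Types (phi : V -> V) (u v x y : V) (vs ws : seq V).

Lemma totderiv_cons phi v vs :
  totderiv phi (v :: vs) = fun y => 'd (totderiv phi vs) y v.
Proof. exact: erefl. Qed.

Lemma totderiv_cat phi vs ws :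
  totderiv phi (vs ++ ws) = totderiv (totderiv phi ws) vs.
Proof. by elim: vs => [//|v vs IH]; rewrite cat_cons totderiv_cons IH. Qed.

Lemma cont_diff_totderiv p phi ws : cont_diff p phi ->
  forall q, (q + size ws <= p)%N -> cont_diff q (totderiv phi ws).
Proof.
move=> [dphi cphi] q qp; split=> vs vsq; rewrite -totderiv_cat.
  by apply: dphi; rewrite size_cat (leq_trans _ qp) // ltn_add2r.
by apply: cphi; rewrite size_cat (leq_trans _ qp) // leq_add2r.
Qed.

Lemma totderiv_swap p phi u v ws : cont_diff p phi -> ((size ws).+2 <= p)%N ->
  totderiv phi [:: u, v & ws] = totderiv phi [:: v, u & ws].
Proof.
move=> Cphi szp.
rewrite -[[:: u, v & ws]]/([:: u; v] ++ ws) -[[:: v, u & ws]]/([:: v; u] ++ ws).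
by rewrite !totderiv_cat diff_swap //; apply: cont_diff_totderiv Cphi _ _.
Qed.

Lemma totderiv_rot1 p phi us v ws : cont_diff p phi ->
  ((size us + size ws).+1 <= p)%N ->
  totderiv phi (us ++ v :: ws) = totderiv phi (v :: us ++ ws).
Proof.
move=> Cphi; elim: us => [//|u us IH] szp.
rewrite !cat_cons totderiv_cons IH; last exact: ltnW.
by rewrite -totderiv_cons (totderiv_swap _ _ Cphi) // size_cat.
Qed.

Lemma totderiv_perm p phi vs ws : cont_diff p phi -> (size vs <= p)%N ->
  perm_eq vs ws -> totderiv phi vs = totderiv phi ws.
Proof.
move=> Cphi; elim: vs ws => [|v vs IH] ws vsp pvw.
  by move: pvw; rewrite perm_sym => /perm_nilP ->.
have /path.splitPr : v \in ws by rewrite -(perm_mem pvw) mem_head.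
move=> E; case: E pvw => w1 w2 pvw.
have szw : size (w1 ++ w2) = size vs.
  by have := perm_size pvw; rewrite !size_cat /= addnS => -[].
have szw' : ((size w1 + size w2).+1 <= p)%N by rewrite -size_cat szw.
have pw : perm_eq vs (w1 ++ w2).
  by rewrite -(perm_cons v) (perm_trans pvw) // -cat1s perm_catCA.
by rewrite (totderiv_rot1 v Cphi szw') !totderiv_cons (IH _ (ltnW vsp) pw).
Qed.

End TotalDerivatives.

(** * Symmetric multilinear maps on lists of vectors *)

Section SymmetricMultilinear.
Variables (R : realType) (V : normedModType R) (W : lmodType R).

(* Linearity in the first argument suffices, by symmetry. *)
Definition symlin (n : nat) (psi : seq V -> W) : Prop :=
  (forall vs ws, size vs = n -> perm_eq vs ws -> psi vs = psi ws) /\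
  (forall a v w us, (size us).+1 = n ->
     psi ((a *: v + w) :: us) = a *: psi (v :: us) + psi (w :: us)).

Lemma symlin_cons n psi v : symlin n.+1 psi -> symlin n (fun vs => psi (v :: vs)).
Proof.
move=> [ps pl]; split=> [vs ws vsn pvw|a u w us usn].
  by apply: ps; rewrite ?perm_cons //= vsn.
have swap z : psi [:: v, z & us] = psi [:: z, v & us].
  by apply: ps; rewrite /= ?usn // -(cat1s v) -(cat1s z) perm_catCA.
by rewrite !swap pl //= usn.
Qed.

Section Order.
Variables (n : nat) (psi : seq V -> W) (spsi : symlin n.+1 psi).

Lemma symlinD v w us : size us = n ->
  psi ((v + w) :: us) = psi (v :: us) + psi (w :: us).
Proof. by move=> sz; have := spsi.2 1 v w us; rewrite sz !scale1r => ->. Qed.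

Lemma symlin0 us : size us = n -> psi (0 :: us) = 0.
Proof.
move=> sz; apply: (addrI (psi (0 :: us))).
by rewrite -symlinD // !addr0.
Qed.

Lemma symlinZ a v us : size us = n -> psi ((a *: v) :: us) = a *: psi (v :: us).
Proof.
by move=> sz; have := spsi.2 a v 0 us; rewrite sz addr0 symlin0 // addr0 => ->.
Qed.

Lemma symlinB v w us : size us = n ->
  psi ((v - w) :: us) = psi (v :: us) - psi (w :: us).
Proof. by move=> sz; rewrite symlinD // -[- w]scaleN1r symlinZ // scaleN1r. Qed.

Lemma symlin_sum (I : Type) (r : seq I) (P : pred I) (F : I -> V) us :
  size us = n ->
  psi ((\sum_(i <- r | P i) F i) :: us) = \sum_(i <- r | P i) psi (F i :: us).
Proof.
move=> sz; elim: r => [|i r IH]; first by rewrite !big_nil symlin0.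
by rewrite !big_cons; case: (P i); rewrite // symlinD // IH.
Qed.

End Order.

Lemma symlin_has0 n psi vs : symlin n psi -> size vs = n -> 0 \in vs -> psi vs = 0.
Proof.
move=> spsi sz v0; have pv := perm_to_rem v0.
have szr : (size (rem 0 vs)).+1 = n by rewrite -sz (perm_size pv).
rewrite (spsi.1 _ _ sz pv); move: spsi; rewrite -szr => spsi.
exact: (symlin0 spsi).
Qed.

End SymmetricMultilinear.

(** * Bounds and Taylor's formula for total derivatives *)

Section TotalDerivativeEstimates.
Variables (R : realType) (m : nat).
Local Notation V := 'rV[R]_m.
Implicit Types (phi : V -> V) (u v x y : V) (vs ws : seq V).

Lemma symlin_totderiv p n phi y : cont_diff p phi -> (n <= p)%N ->
  symlin n (fun vs => totderiv phi vs y).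
Proof.
move=> Cphi np; split=> [vs ws vsn pvw|a v w us usn].
  by rewrite (totderiv_perm Cphi _ pvw) // vsn.
by rewrite /= linearP.
Qed.

(** Expanding the n arguments in the standard basis gives [m ^ n] terms; in the sup norm each
    coordinate is at most the norm of its vector. *)
Lemma symlin_basis_bound n (psi : seq V -> V) (B : R) : symlin n psi -> 0 <= B ->
  (forall js : seq 'I_m, size js = n -> `|psi [seq 'e_j | j <- js]| <= B) ->
  forall vs, size vs = n -> `|psi vs| <= m%:R ^+ n * B * \prod_(v <- vs) `|v|.
Proof.
elim: n psi => [|n IH] psi spsi B0 HB vs; first by case: vs => // _;
  rewrite expr0 mul1r big_nil mulr1; apply: (HB [::]).
case: vs => // v vs [vsn].
have {1}-> := row_sum_delta v.
rewrite (symlin_sum spsi) //; apply: le_trans (ler_norm_sum _ _ _) _.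
apply: (@le_trans _ _ (\sum_(j < m) (`|v| * (m%:R ^+ n * B * \prod_(w <- vs) `|w|))));
  last first.
  rewrite sumr_const card_ord big_cons; set P := \prod_(_ <- _) _.
  by rewrite -[leLHS]mulr_natl exprS le_eqVlt; apply/orP; left; apply/eqP; ring.
apply: ler_sum => j _; rewrite (symlinZ spsi) // normrZ.
apply: ler_pM => //; first exact: coord_norm_le.
apply: (IH (fun ws => psi ('e_j :: ws))) => //; first exact: symlin_cons.
by move=> js jsn; apply: (HB (j :: js)); rewrite /= jsn.
Qed.

Lemma continuous_bounded_on_ball phi (M : R) : continuous phi ->
  exists2 B : R, 0 <= B & forall y, `|y| <= M -> `|phi y| <= B.
Proof.
move=> cphi; pose A := [set y : V | `|y| <= M].
(* For negative [M] the ball is empty and any bound works. *)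
have [[y0 Ay0]|A0] := pselect (A !=set0); last first.
  by exists 0 => // y yM; case: A0; exists y.
have cA : compact A.
  apply: bounded_closed_compact.
    exists M; split; first exact: num_real.
    by move=> N MN y /= yM; apply: le_trans yM (ltW MN).
  apply: (@closed_comp _ _ (fun y : V => `|y|) [set r | r <= M]); last exact: closed_le.
  by move=> y _; apply: norm_continuous.
have [|c Ac Hc] := @EVT_max_rV R m (fun y => `|phi y|) A (ex_intro _ _ Ay0) cA.
  apply: continuous_subspaceT => y.
  by apply: (@continuous_comp _ _ _ phi (fun z : V => `|z|));
    [exact: cphi|exact: norm_continuous].
exists `|phi c| => // y yM; apply: Hc.
by rewrite inE.
Qed.

(** Compactness bounds the finitely many evaluations on basis vectors, and multilinearity extends
    their common bound to all directions. *)
Lemma totderiv_bound p phi (M : R) n : cont_diff p phi -> (n <= p)%N ->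
  exists2 L : R, 0 <= L & forall y, `|y| <= M -> forall vs, size vs = n ->
    `|totderiv phi vs y| <= L * \prod_(v <- vs) `|v|.
Proof.
move=> Cphi np.
have [b Hb] : {b : n.-tuple 'I_m -> R & forall js, 0 <= b js /\ forall y, `|y| <= M ->
    `|totderiv phi [seq 'e_j | j <- js] y| <= b js}.
  apply: (@choice _ _ (fun (js : n.-tuple 'I_m) (B : R) =>
    0 <= B /\ forall y, `|y| <= M ->
    `|totderiv phi [seq 'e_j | j <- js] y| <= B)) => js.
  have [|B B0 HB] := @continuous_bounded_on_ball (totderiv phi [seq 'e_j | j <- js]) M.
    by apply: Cphi.2; rewrite size_map size_tuple.
  by exists B.
pose B := \sum_js b js.
have B0 : 0 <= B by apply: sumr_ge0 => js _; case: (Hb js).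
exists (m%:R ^+ n * B); first by rewrite mulr_ge0 ?exprn_ge0.
move=> y yM vs vsn.
apply: (symlin_basis_bound (symlin_totderiv y Cphi np)) => // js /eqP jsn.
have [_ /(_ _ yM)] := Hb (Tuple jsn); move=> /le_trans; apply.
rewrite /B (bigD1 (Tuple jsn)) //= lerDl.
by apply: sumr_ge0 => i _; case: (Hb i).
Qed.

(** [g i] plays the i-th derivative of [g 0]. The remainder vanishes at 0 and its derivative is the
    remainder of [g 1] of one order less, so the mean value theorem on [0, t] with t <= 1 propagates
    the bound. The usual factor 1/r! is given up, since only the order matters later. *)
Lemma taylor_real (r : nat) (g : nat -> R -> R) (M : R) :
  (forall i, (i < r)%N -> forall t : R, is_derive t 1 (g i) (g i.+1 t)) ->
  (forall t, 0 <= t <= 1 -> `|g r t| <= M) ->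
  forall t, 0 <= t <= 1 -> `|g 0 t - \sum_(i < r) (i`!%:R^-1 * t ^+ i) * g i 0| <= M.
Proof.
elim: r g => [|r IH] g dg gM t t01; first by rewrite big_ord0 subr0; apply: gM.
pose e (t : R) := g 0 t - \sum_(i < r.+1) (i`!%:R^-1 * t ^+ i) * g i 0.
pose de (t : R) := g 1 t - \sum_(i < r) (i`!%:R^-1 * t ^+ i) * g i.+1 0.
have de_bound s : 0 <= s <= 1 -> `|de s| <= M.
  by apply: (IH (fun i => g i.+1)) => // i ir s'; apply: dg.
have eE : e = g 0 - \sum_(i < r.+1) (fun t : R => (i`!%:R^-1 * t ^+ i) * g i 0).
  by apply/funext => s; rewrite /e !fctE fct_sumE.
have dmon (i : nat) (s : R) : is_derive s 1 (fun t : R => (i`!%:R^-1 * t ^+ i) * g i 0)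
    (i`!%:R^-1 * (i%:R * s ^+ i.-1) * g i 0).
  have -> : (fun t : R => (i`!%:R^-1 * t ^+ i) * g i 0) =
            (i`!%:R^-1 * g i 0) *: (@id R ^+ i).
    by apply/funext => x; rewrite !fctE /GRing.scale /= mulrAC.
  apply: is_derive_eq.
  by rewrite /GRing.scale /= mulr1; ring.
have dE (s : R) : is_derive s 1 e (de s).
  rewrite eE; apply: is_derive_eq
    (is_deriveB (dg 0 isT s) (is_derive_sum (fun i : 'I_r.+1 => dmon i s))) _.
  rewrite /de; congr (_ - _); rewrite big_ord_recl /= mul0r mulr0 mul0r add0r.
  apply: eq_bigr => i _; rewrite /bump /= add1n factS natrM invfM.
  by congr (_ * _); rewrite mulrACA mulVf ?mul1r // pnatr_eq0.
have e0 : e 0 = 0.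
  rewrite /e big_ord_recl /= expr0 fact0 invr1 mulr1 mul1r big1 ?addr0 ?subrr // => i _.
  by rewrite exprS mul0r mulr0 mul0r.
have /andP[t0 t1] := t01.
have [c /andP[c0 ct]] := mean_value t0 (fun s _ => dE s).
rewrite e0 !subr0 -/(e t) => ->; rewrite normrM (ger0_norm t0).
apply: le_trans (ler_wpM2l _ t1) _ => //; rewrite mulr1.
by apply: de_bound; rewrite c0 (le_trans ct).
Qed.

Lemma taylor_totderiv r phi (M : R) y v : cont_diff r phi -> 0 <= M ->
  (forall t, 0 <= t <= 1 -> `|totderiv phi (nseq r v) (y + t *: v)| <= M) ->
  `|phi (y + v) - \sum_(i < r) i`!%:R^-1 *: totderiv phi (nseq i v) y| <= M.
Proof.
move=> [dphi _] M0 HM; apply: rv_norm_le => // j.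
pose g i t := totderiv phi (nseq i v) (y + t *: v) 0 j.
have := @taylor_real r g M _ _ 1; rewrite ler01 lexx => T1.
have E : (phi (y + v) - \sum_(i < r) i`!%:R^-1 *: totderiv phi (nseq i v) y) 0 j =
    g 0 1 - \sum_(i < r) (i`!%:R^-1 * 1 ^+ i) * g i 0.
  rewrite /g !mxE scale1r; congr (_ - _); rewrite summxE; apply: eq_bigr => i _.
  by rewrite mxE expr1n mulr1 scale0r addr0.
rewrite E; apply: T1 => // [i ir t|t /HM]; last by apply: le_trans;
  apply: coord_norm_le.
apply: (is_derive_coord_line (phi := totderiv phi (nseq i v))).
by apply: dphi; rewrite size_nseq.
Qed.

End TotalDerivativeEstimates.

(** * Sums over multisets *)

Section MultisetSums.
Variable (K : choiceType).
Implicit Types (t : K) (g h : {mset K}%mset).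

Lemma perm_msetD g h : perm_eq (msetD g h) ((g : seq K) ++ (h : seq K)).
Proof. by apply/allP => t _ /=; rewrite count_cat !count_mem_mset msetE2. Qed.

Lemma perm_mset_cons t h : perm_eq (msetD (msetn 1 t) h) (t :: h).
Proof.
apply: perm_trans (perm_msetD _ _) _; rewrite -cat1s perm_cat2r.
by apply/allP => x _ /=; rewrite count_mem_mset msetnE addn0 [t == x]eq_sym; case: ifP.
Qed.

Lemma size_mset_cons t h : size (msetD (msetn 1 t) h) = (size h).+1.
Proof. exact: perm_size (perm_mset_cons t h). Qed.

(** The factor $r_1! \cdots r_q!$ contributed by the root to the symmetry factor of [bplus i h]. *)
Definition mfact h : nat := (\prod_(t <- undup h) (h t)`!)%N.

Lemma mfactE h (r : seq K) : uniq r -> {subset (h : seq K) <= r} ->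
  mfact h = (\prod_(t <- r) (h t)`!)%N.
Proof.
move=> ur hr; rewrite [RHS](bigID (mem h)) /= [X in (_ * X)%N]big1 ?muln1; last first.
  by move=> t; rewrite -mset_eq0 => /eqP ->.
rewrite -big_filter; apply: perm_big; apply: uniq_perm;
  rewrite ?undup_uniq ?filter_uniq //.
by move=> t; rewrite mem_undup mem_filter; case th: (t \in h) => //=; rewrite hr.
Qed.

Lemma mfact_cons t h : mfact (msetD (msetn 1 t) h) = ((h t).+1 * mfact h)%N.
Proof.
set r := undup (t :: h); have ur : uniq r by rewrite undup_uniq.
have tr : t \in r by rewrite mem_undup mem_head.
rewrite (mfactE ur); last by move=> x;
  rewrite (perm_mem (perm_mset_cons t h)) mem_undup.
rewrite (@mfactE h r) //; last by move=> x xh; rewrite mem_undup inE xh orbT.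
rewrite !(bigD1_seq t tr ur) /= msetE2 msetnxx add1n factS -mulnA;
  congr (_ * (_ * _))%N.
by apply: eq_bigr => x xt; rewrite msetE2 msetnE (negbTE xt).
Qed.

Lemma finite_msets (A : {fset K}%fset) n :
  finite_set [set h : {mset K}%mset | size h = n /\ {subset (h : seq K) <= A}].
Proof.
have := finite_image (@seq_mset K) (finite_seq_upto n (finite_fset A)).
apply: sub_finite_set => h [hn hA]; exists (h : seq K); last exact: seq_mset_id.
by split; [rewrite hn|move=> x /hA].
Qed.

(** Grading by cardinality allows one element to be removed whatever its weight; the grading of
    forests by vertices returns in [sum_msets_forests_le]. *)
Definition msets (A : {fset K}%fset) n : {fset {mset K}%mset}%fset :=
  fset_set [set h : {mset K}%mset | size h = n /\ {subset (h : seq K) <= A}].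

Lemma msetsP (A : {fset K}%fset) n h :
  reflect (size h = n /\ {subset (h : seq K) <= A}) (h \in msets A n).
Proof.
by rewrite /msets in_fset_set ?inE; [apply: asboolP|apply: finite_msets].
Qed.

Lemma msets_cons (A : {fset K}%fset) n t h : t \in A ->
  (msetD (msetn 1 t) h \in msets A n.+1) = (h \in msets A n).
Proof.
move=> tA; have mE := perm_mem (perm_mset_cons t h).
apply/msetsP/msetsP; rewrite size_mset_cons => -[].
  by move=> [<-] sA; split=> // x xh; apply: sA; rewrite mE inE xh orbT.
by move=> <- sA; split=> // x; rewrite mE inE => /predU1P[->//|/sA].
Qed.

Lemma msets0 (A : {fset K}%fset) : perm_eq (msets A 0) [:: mset0].
Proof.
apply: uniq_perm => // h; rewrite inE; apply/msetsP/idP.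
  by move=> [/eqP]; rewrite size_mset_eq0.
by move=> /eqP ->; rewrite size_mset0; split => // x; rewrite in_mset0.
Qed.

Section Vectors.
Variables (R : numFieldType) (W : lmodType R).

(** Adding [t] is a bijection onto the multisets that contain [t]; the others have weight
    [h t = 0]. *)
Lemma sum_msets_mult (A : {fset K}%fset) n t (Phi : {mset K}%mset -> W) : t \in A ->
  \sum_(h <- msets A n.+1) (h t)%:R *: Phi h =
  \sum_(h <- msets A n) (h t).+1%:R *: Phi (msetD (msetn 1 t) h).
Proof.
move=> tA; rewrite (bigID (fun h => t \in h)) /= [X in _ + X]big1 ?addr0; last first.
  by move=> h; rewrite -mset_eq0 => /eqP ->; rewrite scale0r.
rewrite -big_filter.
have p : perm_eq [seq h <- enum_fset (msets A n.+1) | t \in (h : {mset K}%mset)]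
      [seq msetD (msetn 1 t) h | h <- enum_fset (msets A n)].
  apply: uniq_perm; rewrite ?filter_uniq ?fset_uniq // ?map_inj_uniq ?fset_uniq //.
    exact: can_inj (msetDKB (msetn 1 t)).
  move=> h; rewrite mem_filter; apply/andP/mapP => [[th hA]|[g gA ->]].
    by exists (msetB h (msetn 1 t)); rewrite ?msetB1K // -(msets_cons _ _ tA) msetB1K.
  by rewrite msets_cons // mset1D1.
rewrite (perm_big _ p) /= big_map; apply: eq_bigr => h _.
by rewrite msetE2 msetnxx add1n.
Qed.

(** The factor n + 1 is the sum of the multiplicities of [h]. Marking an occurrence of [t] turns
    [h t / mfact h] into the inverse of [mfact] of the remaining multiset. *)
Lemma sum_msets_rec (A : {fset K}%fset) n (Phi : {mset K}%mset -> W) :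
  n.+1%:R *: \sum_(h <- msets A n.+1) (mfact h)%:R^-1 *: Phi h =
  \sum_(t <- A) \sum_(h <- msets A n) (mfact h)%:R^-1 *: Phi (msetD (msetn 1 t) h).
Proof.
transitivity (\sum_(t <- A) \sum_(h <- msets A n.+1) (h t)%:R *: ((mfact h)%:R^-1 *:
  Phi h)).
  rewrite exchange_big scaler_sumr /= big_seq [RHS]big_seq;
    apply: eq_bigr => h /msetsP[hn hA].
  rewrite -scaler_suml; congr (_ *: _); rewrite -hn -natr_sum; congr _%:R.
  rewrite size_mset [RHS](bigID (fun t =>
    t \in (h : {mset K}%mset))) /= [X in (_ + X)%N]big1 ?addn0; last first.
    by move=> t; rewrite -mset_eq0 => /eqP ->.
  rewrite -[RHS]big_filter; apply: perm_big; apply: uniq_perm;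
    rewrite ?filter_uniq ?fset_uniq //.
  by move=> t; rewrite msuppE mem_filter; case th: (t \in (h : {mset K}%mset)) => //=;
    rewrite hA.
rewrite big_seq [RHS]big_seq; apply: eq_bigr => t tA; rewrite sum_msets_mult //.
apply: eq_bigr => h _; rewrite scalerA mfact_cons natrM invfM mulrA mulfV ?mul1r
  ?pnatr_eq0 //.
Qed.

End Vectors.
End MultisetSums.

(** * The exponential identity for sums over multisets *)

Section MultisetExponential.
Variables (K : choiceType) (R : realType) (V : normedModType R) (W : lmodType R).
Implicit Types (t : K) (g h : {mset K}%mset).

(* [1 / (n - k)!], extended by 0 to [k > n] so that the recursions below hold
   without side conditions. *)
Definition invfact (n k : nat) : R := if (k <= n)%N then (n - k)`!%:R^-1 else 0.

Lemma invfactSl n k : (n.+1%:R - k%:R) * invfact n.+1 k = invfact n k.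
Proof.
rewrite /invfact; case: (ltngtP k n.+1) => [kn|nk|->].
- have kn' : (k <= n)%N := kn.
  rewrite kn' -natrB ?leqW // subSn // factS natrM invfM mulrA.
  by rewrite mulfV ?mul1r ?pnatr_eq0.
- by rewrite leqNgt (ltn_trans _ nk) // mulr0.
- by rewrite subrr mul0r ltnn.
Qed.

Lemma invfactSS n k : invfact n.+1 k.+1 = invfact n k.
Proof. by rewrite /invfact ltnS subSS. Qed.

Lemma mset_decomp_mfact t g : t \in g ->
  (mfact (msetB g (msetn 1 t)))%:R^-1 = (g t)%:R * (mfact g)%:R^-1 :> R.
Proof.
move=> tg; have gE := msetB1K tg; set h := msetB _ _ in gE *.
rewrite -gE mfact_cons msetE2 msetnxx add1n natrM invfM mulrA mulfV ?mul1r //.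
Qed.

Variables (A : {fset K}%fset) (G : K -> V) (c0 : K -> R) (c1 : K -> K -> R).
(** Abstracts the coefficient of [g] after pairing the first factor of Delta h with a character:
    each element [t] of [h] becomes a scalar [c0 t], or one element [s] of [g] with weight
    [c1 t s]. *)
Variable kappa : {mset K}%mset -> {mset K}%mset -> R.
Hypothesis kappa0 : forall g, kappa mset0 g = (g == mset0)%:R.
Hypothesis kappaS : forall t h g, kappa (msetD (msetn 1 t) h) g =
  c0 t * kappa h g +
  \sum_(s <- undup (g : seq K)) c1 t s * kappa h (msetB g (msetn 1 s)).

Let C0 : V := \sum_(t <- A) c0 t *: G t.
Let C1 s : V := \sum_(t <- A) c1 t s *: G t.

(* Let S_n(g; psi) be the left-hand side. Splitting off one element of h gives
   n S_n(g; psi) = S_(n-1)(g; psi(C0, -)) + sum_s S_(n-1)(g - s; psi(C1 s, -)),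
   with s ranging over the support of g; the right-hand side satisfies the same
   recursion because the multiplicities of g sum to [size g]. *)
Lemma mset_exponential n (psi : seq V -> W) g : symlin n psi ->
  \sum_(h <- msets A n) (mfact h)%:R^-1 *: (kappa h g *: psi [seq G t | t <- (h :
    {mset K}%mset)]) =
  (invfact n (size g) * (mfact g)%:R^-1) *:
    psi (nseq (n - size g) C0 ++ [seq C1 s | s <- (g : seq K)]).
Proof.
elim: n psi g => [|n IH] psi g spsi.
  rewrite (perm_big _ (msets0 A)) /= big_seq1 kappa0.
  rewrite /mfact enum_mset0 big_nil invr1 scale1r.
  case: eqP => [->|/eqP g0].
    by rewrite /invfact size_mset0 /mfact enum_mset0 big_nil /= invr1 mulr1 !scale1r.
  by rewrite scale0r /invfact leqn0 size_mset_eq0 (negbTE g0) mul0r scale0r.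
apply: (@scalerI _ _ n.+1%:R); first by rewrite pnatr_eq0.
rewrite sum_msets_rec exchange_big /=.
pose psi' v := fun vs => psi (v :: vs).
have spsi' v : symlin n (psi' v) by exact: symlin_cons.
transitivity (\sum_(h <- msets A n) (mfact h)%:R^-1 *: (kappa h g *:
  psi' C0 [seq G t | t <- (h : {mset K}%mset)])
  + \sum_(s <- undup (g : seq K)) \sum_(h <- msets A n) (mfact h)%:R^-1 *:
      (kappa h (msetB g (msetn 1 s)) *: psi' (C1 s) [seq G t | t <- (h :
        {mset K}%mset)])).
  rewrite [X in _ = _ + X]exchange_big -big_split /= big_seq [RHS]big_seq.
  apply: eq_bigr => h /msetsP[hn hA].
  rewrite -!scaler_sumr -scalerDr; congr (_ *: _).
  have szG : size [seq G t | t <- (h : {mset K}%mset)] = n by rewrite size_map.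
  rewrite /psi' /C0 (symlin_sum spsi) // scaler_sumr.
  under [X in _ = _ + X]eq_bigr => s _ do rewrite /C1 (symlin_sum spsi) // scaler_sumr.
  rewrite exchange_big -big_split /=; apply: eq_bigr => t _.
  rewrite (spsi.1 _ (G t :: [seq G x | x <- (h : {mset K}%mset)])); last 2 first.
  - by rewrite size_map size_mset_cons hn.
  - exact: (perm_map G (perm_mset_cons t h)).
  rewrite kappaS scalerDl scaler_suml (symlinZ spsi) // scalerA mulrC; congr (_ + _).
  by apply: eq_bigr => s _; rewrite (symlinZ spsi) // scalerA mulrC.
rewrite IH //.
under eq_bigr => s _ do rewrite IH //.
have E0 : (size g <= n)%N ->
    psi' C0 (nseq (n - size g) C0 ++ [seq C1 s | s <- (g : seq K)]) =
    psi (nseq (n.+1 - size g) C0 ++ [seq C1 s | s <- (g : seq K)]).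
  by move=> gn; rewrite subSn.
have szB s : s \in g -> (size (msetB g (msetn 1 s))).+1 = size g.
  by move=> sg; rewrite -[in RHS](msetB1K sg) size_mset_cons.
have E1 s : s \in g -> (size g <= n.+1)%N ->
    psi' (C1 s) (nseq (n - size (msetB g (msetn 1 s))) C0 ++
       [seq C1 s | s <- (msetB g (msetn 1 s) : seq K)]) =
    psi (nseq (n.+1 - size g) C0 ++ [seq C1 s | s <- (g : seq K)]).
  move=> sg gn; rewrite /psi'; apply: spsi.1.
    by rewrite /= size_cat size_nseq size_map -(szB s sg) in gn *; rewrite subnK.
  rewrite -(szB s sg) subSS -cat1s perm_catCA perm_cat2l /=.
  have := perm_map C1 (perm_mset_cons s (msetB g (msetn 1 s))).
  by rewrite msetB1K // perm_sym.
set P := psi (nseq (n.+1 - size g) C0 ++ _) in E0 E1 *.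
transitivity ((invfact n (size g) * (mfact g)%:R^-1) *: P +
   \sum_(s <- undup (g : seq K)) ((g s)%:R * (invfact n.+1 (size g) * (mfact
     g)%:R^-1)) *: P).
  congr (_ + _).
    (* If [size g > n], the subtraction truncates and the two argument lists differ in length, but
       both coefficients are 0. *)
    have [gn|ng] := leqP (size g) n; first by rewrite E0.
    by rewrite /invfact leqNgt ng mul0r !scale0r.
  rewrite big_seq [RHS]big_seq; apply: eq_bigr => s; rewrite mem_undup => sg.
  rewrite mset_decomp_mfact // -invfactSS szB //.
  have [gn|ng] := leqP (size g) n.+1; first by rewrite E1 // mulrCA.
  by rewrite /invfact leqNgt ng !mul0r mulr0 !scale0r.
rewrite -scaler_suml -scalerDl scalerA -mulr_suml -natr_sum.
have -> : (\sum_(s <- undup (g : seq K)) g s)%N = size g.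
  by rewrite size_mset; apply: perm_big; apply: perm_undup_mset.
(* With k = [size g], the coefficients (n + 1 - k) [invfact n.+1 k] and k [invfact n.+1 k] add up to
   (n + 1) [invfact n.+1 k]. *)
by rewrite -invfactSl; congr (_ *: _); ring.
Qed.

End MultisetExponential.

(** * Forests and the coproduct *)

(** Arrangements are sorted by their first element [t]. Removing it divides [mfact h] by [h t], so
    those starting with [t] account for [h t] times n!, and the multiplicities add up to
    [size h]. *)
Lemma size_permutations_mset (K : choiceType) (h : {mset K}%mset) :
  (size (permutations h) * mfact h = (size h)`!)%N.
Proof.
move: {2}(size h) (erefl (size h)) => n; elim: n h => [|n IH] h hn.
  by move/eqP: hn; rewrite size_mset_eq0 => /eqP ->; rewrite /mfact enum_mset0 big_nil.
have h0 : (0 < size h)%N by rewrite hn.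
rewrite (perm_size (permutationsE h0)) size_allpairs_dep sumn_map big_distrl /=.
transitivity (\sum_(t <- undup (h : seq K)) h t * n`!)%N.
  apply: eq_big_seq => t; rewrite mem_undup => th.
  have hE := msetB1K th; set g := msetB _ _ in hE.
  have pg : perm_eq (rem t h) g.
    rewrite -(perm_cons t) perm_sym -(permPl (perm_mset_cons t g)) hE.
    exact: perm_to_rem.
  have gn : size g = n by move: hn; rewrite -hE size_mset_cons => -[].
  rewrite (perm_size (perm_permutations pg)) -{1}hE mfact_cons mulnCA IH // gn.
  by rewrite -[in RHS]hE msetE2 msetnxx add1n.
rewrite -big_distrl /= hn factS -hn; congr (_ * _)%N.
by rewrite size_mset; apply: perm_big; apply: perm_undup_mset.
Qed.

Section Forests.
Variable d : nat.
Implicit Types (t s : tree d) (g h : forest d).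

Lemma tree_bplus_ind (P : tree d -> Prop) :
  (forall i h, (forall t, t \in h -> P t) -> P (bplus i h)) -> forall t, P t.
Proof.
move=> H t; move: {2}(tree_size t) (leqnn (tree_size t)) => n.
elim: n t => [|n IH] t; rewrite -(bplus_tree_branches t) tree_size_bplus // ltnS => tn.
by apply: H => s /forest_size_mem sn; apply: IH; apply: leq_trans tn.
Qed.

Lemma tree_size_gt0 t : (0 < tree_size t)%N.
Proof. by rewrite -(bplus_tree_branches t) tree_size_bplus. Qed.

Lemma forest_size0 : forest_size (unit_forest d) = 0%N.
Proof. by rewrite /forest_size enum_mset0 big_nil. Qed.

Lemma forest_size_tree t : forest_size (tree_forest t) = tree_size t.
Proof.
have := perm_mset_cons t (unit_forest d); rewrite msetD0 enum_mset0 => p.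
by rewrite /forest_size (perm_big _ p) big_seq1.
Qed.

Lemma forest_size_cons t h :
  forest_size (msetD (tree_forest t) h) = (tree_size t + forest_size h)%N.
Proof. by rewrite forest_sizeD forest_size_tree. Qed.

Lemma tree_forest_inj : injective (@tree_forest d).
Proof. exact: msetn_inj. Qed.

Lemma tree_forest_neq0 t : tree_forest t != unit_forest d.
Proof.
by apply/eqP => E; have := forest_size_tree t; rewrite E forest_size0;
  have := tree_size_gt0 t; case: tree_size.
Qed.

Lemma forest_size_eq0 h : forest_size h = 0%N -> h = unit_forest d.
Proof.
by have := forest_size_ge h; move=> + h0; rewrite h0 leqn0 size_mset_eq0 => /eqP.
Qed.

Lemma symfactor_bplus_mfact i h :
  symfactor (bplus i h) = (mfact h * \prod_(t <- (h : seq (tree d))) symfactor t)%N.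
Proof. exact: symfactor_bplus. Qed.

Lemma cop0 : cop (unit_forest d) = [:: (unit_forest d, unit_forest d)].
Proof. by rewrite /cop enum_mset0. Qed.

Section CoproductSums.
Variable (U : nmodType).
Implicit Type F : forest d -> forest d -> U.

Lemma sum_cop_tree t F :
  \sum_(p <- cop_tree t) F p.1 p.2 =
  F (tree_forest t) (unit_forest d) +
  \sum_(p <- cop (tree_branches t)) F p.1 (tree_forest (bplus (tree_root t) p.2)).
Proof.
rewrite -{1 2}(bplus_tree_branches t) (perm_big _ (cop_tree_bplus _ _)) big_cons /=.
by rewrite big_map.
Qed.

Lemma sum_cop_cons t h F :
  \sum_(p <- cop (msetD (tree_forest t) h)) F p.1 p.2 =
  \sum_(p <- cop_tree t) \sum_(r <- cop h) F (msetD p.1 r.1) (msetD p.2 r.2).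
Proof.
have p : perm_eq (cop (msetD (tree_forest t) h)) (cop_mul (cop_tree t) (cop h)).
  exact: (perm_cop_prod (perm_map (@cop_tree d) (perm_mset_cons t h))).
by rewrite (perm_big _ p) big_allpairs_dep.
Qed.

Lemma sum_cop_tree_forest t F :
  \sum_(p <- cop (tree_forest t)) F p.1 p.2 = \sum_(p <- cop_tree t) F p.1 p.2.
Proof.
rewrite -[tree_forest t]msetD0 sum_cop_cons cop0.
by apply: eq_bigr => p _; rewrite big_seq1 !msetD0.
Qed.

End CoproductSums.

(** The coproduct is graded. The hypothesis on the members of [l] is what induction on trees
    supplies, so the statement serves [cop_tree_size] first and [cop_size] afterwards. *)
Lemma cop_prod_size (l : seq (tree d)) :
  (forall s, s \in l -> forall p, p \in cop_tree s ->
    (forest_size p.1 + forest_size p.2 = tree_size s)%N) ->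
  forall p, p \in cop_prod [seq cop_tree t | t <- l] ->
    (forest_size p.1 + forest_size p.2 = \sum_(t <- l) tree_size t)%N.
Proof.
elim: l => [|s l IH] H q.
  by rewrite inE => /eqP -> /=; rewrite forest_size0 big_nil.
move=> /allpairsP[[a b] /= [aP bP ->]] /=.
rewrite !forest_sizeD addnACA big_cons.
rewrite (H s (mem_head _ _) _ aP); congr (_ + _)%N; apply: IH => // u ul.
by apply: H; rewrite inE ul orbT.
Qed.

Lemma cop_tree_size t p : p \in cop_tree t ->
  (forest_size p.1 + forest_size p.2 = tree_size t)%N.
Proof.
move: t p; elim/tree_bplus_ind => i h IH p.
rewrite (perm_mem (cop_tree_bplus i h)) inE =>
  /predU1P[->|/mapP[q /(cop_prod_size IH) E ->]] /=.
  by rewrite forest_size_tree forest_size0 addn0.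
by rewrite forest_size_tree !tree_size_bplus addnS E.
Qed.

Lemma cop_size h p : p \in cop h ->
  (forest_size p.1 + forest_size p.2 = forest_size h)%N.
Proof. by apply: cop_prod_size => s _; apply: cop_tree_size. Qed.

Definition trees_le q : {fset tree d}%fset := fset_set [set t | (tree_size t <= q)%N].
Definition forests_le q : {fset forest d}%fset := fset_set [set h | (forest_size h <=
  q)%N].

Lemma trees_leP q t : (t \in trees_le q) = (tree_size t <= q)%N.
Proof.
rewrite in_fset_set; last exact: finite_tree_le.
by apply/idP/idP; rewrite inE.
Qed.

Lemma forests_leP q h : (h \in forests_le q) = (forest_size h <= q)%N.
Proof.
rewrite in_fset_set; last exact: finite_forest_le.
by apply/idP/idP; rewrite inE.
Qed.

(** [bplus] is a bijection that adds one vertex. The shift matches the forests with at most N - 1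
    vertices in the Riemann sums with the trees of Xi^N. *)
Lemma sum_trees_le (U : nmodType) q (F : tree d -> U) :
  \sum_(t <- trees_le q.+1) F t = \sum_(i < d) \sum_(h <- forests_le q) F (bplus i h).
Proof.
have bplus_inj i h j g : bplus i h = bplus j g -> i = j /\ h = g.
  move=> E; split.
    by rewrite -(tree_root_bplus i h) E tree_root_bplus.
  by rewrite -(tree_branches_bplus i h) E tree_branches_bplus.
transitivity (\sum_(t <- [seq bplus i h | i <- index_enum 'I_d,
    h <- enum_fset (forests_le q)]) F t); last by rewrite big_allpairs_dep.
apply: perm_big; apply: uniq_perm; first exact: fset_uniq.
  apply: allpairs_uniq_dep => [|i _|]; [exact: index_enum_uniq|exact: fset_uniq|].
  by move=> [i h] [j g] _ _ /= /bplus_inj[-> ->].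
move=> t; apply/idP/allpairsPdep => [|[i [h [_ hq ->]]]].
  rewrite trees_leP -(bplus_tree_branches t) tree_size_bplus ltnS => tq.
  by exists (tree_root t), (tree_branches t); rewrite mem_index_enum forests_leP.
by move: hq; rewrite forests_leP trees_leP tree_size_bplus.
Qed.

End Forests.

(** * Coefficients of the coproduct paired with a character *)

Section CoproductCoefficients.
Variables (R : realType) (d : nat).
Implicit Types (a b : hdual R d) (t s : tree d) (g h : forest d).

Definition character a : Prop :=
  a (unit_forest d) = 1 /\ forall g h, a (msetD g h) = a g * a h.

(* The coefficients of g, resp. of the tree s, in (a (x) id)(Delta h), resp.
   in (a (x) id)(Delta t). *)
Definition cop_coef a h g : R := \sum_(p <- cop h | p.2 == g) a p.1.

Definition cop_tcoef a t s : R := \sum_(p <- cop_tree t | p.2 == tree_forest s) a p.1.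

Lemma cop_coef0 a g : character a -> cop_coef a (unit_forest d) g = (g == unit_forest
  d)%:R.
Proof.
move=> [a1 _]; rewrite /cop_coef cop0 big_mkcond big_seq1 /= eq_sym a1.
by case: eqP.
Qed.

Lemma sum_pred1_seq (K : eqType) (U : nmodType) (r : seq K) (x : K) (u : U) : uniq r ->
  \sum_(s <- r) (if s == x then u else 0) = if x \in r then u else 0.
Proof.
move=> ur; rewrite -big_mkcond /=; case: ifP => [xr|/negbT xr].
  by rewrite -big_filter filter_pred1_uniq // big_seq1.
by rewrite -big_filter (eq_in_filter (a2 := pred0)) ?filter_pred0 ?big_nil // => s sr;
  apply/eqP => E; rewrite -E sr in xr.
Qed.

Lemma cop_tcoefE a t s : cop_tcoef a t s =
  \sum_(p <- cop (tree_branches t)) if s == bplus (tree_root t) p.2 then a p.1 else 0.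
Proof.
rewrite /cop_tcoef big_mkcond (sum_cop_tree t (fun x z =>
  if z == tree_forest s then a x else 0)).
rewrite eq_sym (negbTE (tree_forest_neq0 s)) add0r; apply: eq_bigr => p _.
by rewrite (inj_eq (@tree_forest_inj d)) eq_sym.
Qed.

Lemma cop_tcoef_bplus a i j g h :
  cop_tcoef a (bplus j h) (bplus i g) = if i == j then cop_coef a h g else 0.
Proof.
rewrite cop_tcoefE tree_root_bplus tree_branches_bplus /cop_coef.
have [->|ij] := eqVneq i j.
  rewrite [RHS]big_mkcond; apply: eq_bigr => p _; congr (if _ then _ else _).
  apply/eqP/eqP => [E|->//].
  by rewrite -(tree_branches_bplus j g) E tree_branches_bplus.
rewrite big1 // => p _; case: eqP => // E.
by move: ij; rewrite -(tree_root_bplus i g) E tree_root_bplus eqxx.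
Qed.

(** Delta is multiplicative, and the second factor of a term of Delta t is either 1, from the term t
    (x) 1, or a single tree, which must then occur in [g]. This is the recursion [kappaS]. *)
Lemma cop_coef_cons a t h g : character a ->
  cop_coef a (msetD (tree_forest t) h) g =
  a (tree_forest t) * cop_coef a h g +
  \sum_(s <- undup (g : seq (tree d))) cop_tcoef a t s * cop_coef a h (msetB g
    (tree_forest s)).
Proof.
move=> [_ aM]; rewrite /cop_coef big_mkcond.
rewrite (sum_cop_cons t h (fun x z => if z == g then a x else 0)).
rewrite (sum_cop_tree t (fun x z => \sum_(r <- cop h)
  if msetD z r.2 == g then a (msetD x r.1) else 0)).
congr (_ + _).
  rewrite [in RHS]big_mkcond mulr_sumr; apply: eq_bigr => r _.
  by rewrite mset0D; case: ifP; rewrite ?mulr0 ?aM.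
under [RHS]eq_bigr => s _ do rewrite cop_tcoefE mulr_suml.
rewrite [RHS]exchange_big /=; apply: eq_bigr => p _; set s := bplus _ _.
transitivity (\sum_(s' <- undup (g : seq (tree d))) if s' == s then
   a p.1 * cop_coef a h (msetB g (tree_forest s)) else 0); last first.
  by apply: eq_bigr => s' _; case: eqP => [->|]; rewrite ?mul0r.
rewrite sum_pred1_seq ?undup_uniq // mem_undup /cop_coef.
case: ifP => [sg|/negbT sg]; last first.
  rewrite big1 // => r _; case: eqP => // E.
  by move: sg; rewrite -E mset1D1.
rewrite [in RHS]big_mkcond mulr_sumr; apply: eq_bigr => r _.
rewrite -{1}(msetB1K sg) (can_eq (msetDKB (tree_forest s))).
by case: ifP; rewrite ?mulr0 ?aM.
Qed.

End CoproductCoefficients.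

(** * Elementary differentials divided by symmetry factors *)

Section ElementaryDifferentials.
Variables (R : realType) (d m p : nat) (f : 'I_d -> 'rV[R]_m -> 'rV[R]_m).
Hypothesis Cf : forall i, cont_diff p (f i).
Local Notation V := 'rV[R]_m.
Implicit Types (t : tree d) (h : forest d) (y : V).

Lemma symlin_map_scale (W : lmodType R) n (psi : seq V -> W) (K : Type)
    (c : K -> R) (F : K -> V) (l : seq K) : symlin n psi -> size l = n ->
  psi [seq c x *: F x | x <- l] = (\prod_(x <- l) c x) *: psi [seq F x | x <- l].
Proof.
elim: n psi l => [|n IH] psi [|x l] // spsi; first by rewrite big_nil scale1r.
move=> [szl] /=; rewrite (symlinZ spsi) ?size_map //.
by rewrite (IH _ _ (symlin_cons (F x) spsi) szl) big_cons scalerA.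
Qed.

(** [elemdiff] reads the branches in their sorted planar order; passing to the enumeration of [h]
    uses the symmetry of derivatives of order [size h]. *)
Lemma elemdiff_bplus i h y : (size h <= p)%N ->
  elemdiff f (bplus i h) y = totderiv (f i) [seq elemdiff f t y | t <- (h :
    forest d)] y.
Proof.
move=> hp; rewrite /elemdiff pval_bplus.
rewrite -[LHS]/(totderiv (f i) [seq pelemdiff f v y | v <-
  sort (@ple d) [seq pval t | t <- (h : seq (tree d))]] y).
have E := symlin_totderiv y (Cf i) hp;
  rewrite (map_comp (fun v => pelemdiff f v y) (@pval d)).
apply: E.1; first by rewrite size_map size_sort size_map.
exact/perm_map/permEl/perm_sort.
Qed.

(** With sigma absorbed, the recursion on trees carries only the weight 1/[mfact h], the one of
    [mset_exponential]. *)
Definition bcoef t y : V := (symfactor t)%:R^-1 *: elemdiff f t y.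

Lemma bcoef_bplus i h y : (size h <= p)%N ->
  bcoef (bplus i h) y =
    (mfact h)%:R^-1 *: totderiv (f i) [seq bcoef t y | t <- (h : forest d)] y.
Proof.
move=> hp; rewrite /bcoef elemdiff_bplus // symfactor_bplus_mfact natrM invfM -scalerA.
congr (_ *: _).
have E := symlin_map_scale (fun t => (symfactor t)%:R^-1) (fun t => elemdiff f t y)
  (symlin_totderiv y (Cf i) hp) (erefl (size h)).
by rewrite E natr_prod prodfV.
Qed.

End ElementaryDifferentials.

(** * Composition of a controlled path with a smooth map *)

Section ComposedControlledPath.
Variables (R : realType) (d m : nat).
Local Notation V := 'rV[R]_m.
Implicit Types (h g : forest d) (Z : forest d -> V) (phi : V -> V).

Lemma prod_tree_forest (ts : seq (tree d)) :
  \big[@msetD _/unit_forest d]_(g <- [seq tree_forest t | t <- ts]) g = seq_mset ts.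
Proof.
elim: ts => [|t ts IH]; last by rewrite big_cons IH mset_cons.
by rewrite big_nil; apply/msetP => x; rewrite mset_seqE mset0E.
Qed.

Lemma forest_size_factor (hs : seq (forest d)) g : g \in hs ->
  (forest_size g <= forest_size (\big[@msetD _/unit_forest d]_(g <- hs) g))%N.
Proof.
elim: hs => // g' s IH; rewrite inE big_cons forest_sizeD => /predU1P[->|/IH].
  exact: leq_addr.
by move=> /leq_trans; apply; apply: leq_addl.
Qed.

Lemma list_of_trees (hs : seq (forest d)) :
  (exists ts, hs = [seq tree_forest t | t <- ts]) \/
  (exists2 g, g \in hs & forall t, g != tree_forest t).
Proof.
elim: hs => [|g hs [[ts ->]|[g' g'hs Hg']]]; first by left; exists [::].
  have [[t ->]|ng] := pselect (exists t, g = tree_forest t); first by left;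
    exists (t :: ts).
  by right; exists g; rewrite ?mem_head // => t; apply/eqP => E; apply: ng; exists t.
by right; exists g'; rewrite // inE g'hs orbT.
Qed.

(** Since Z vanishes on nonempty forests that are not trees, only factorizations of [h] into single
    trees survive. These are the n!/[mfact h] distinct arrangements of its n trees, each with weight
    1/n! and, by symmetry, the same value. *)
Lemma comp_controlled_trees (alpha : R) phi Z h :
  cont_diff (level alpha) phi -> (forest_size h <= (level alpha).-1)%N ->
  (forall g, (forest_size g <= (level alpha).-1)%N -> g != unit_forest d ->
     (forall t, g != tree_forest t) -> Z g = 0) ->
  comp_controlled alpha phi Z h =
    (mfact h)%:R^-1 *:
      totderiv phi [seq Z (tree_forest t) | t <- (h : forest d)] (Z (unit_forest d)).
Proof.
move=> Cphi hN Z0; rewrite /comp_controlled.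
case: eqP => [->|/eqP h0]; first by rewrite /mfact !enum_mset0 big_nil invr1 scale1r.
rewrite hN; set P := totderiv _ _ _.
have sz_gt0 : (0 < size h)%N by rewrite lt0n size_mset_eq0.
have sz_lt : (size h < level alpha)%N.
  apply: leq_ltn_trans (forest_size_ge h) (leq_ltn_trans hN _).
  case: (level alpha) hN => [|//] hN0; move/eqP: h0; case.
  by apply: forest_size_eq0; apply/eqP; rewrite -leqn0.
transitivity (\sum_(1 <= n < level alpha) if n == size h then (mfact h)%:R^-1 *:
  P else 0); last first.
  rewrite (big_cat_nat (n := size h)) //=; last exact: ltnW.
  rewrite big_nat big1 => [|n /andP[_ nh]]; last by rewrite ltn_eqF.
  rewrite add0r big_ltn // eqxx big_nat big1 ?addr0 // => n /andP[hn _].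
  by rewrite gtn_eqF.
apply: eq_big_nat => n /andP[n1 nN].
(* [insub] keeps the arrangements of length n, hence none unless n is the size of [h]. *)
pose r : seq (n.-tuple (forest d)) :=
  pmap insub [seq [seq tree_forest t | t <- ts] | ts <- permutations (h :
    seq (tree d))].
have mapI : injective (map (@tree_forest d)) by exact/inj_map/tree_forest_inj.
have rP (hs : n.-tuple (forest d)) : hs \in r ->
    exists2 ts, perm_eq ts h & tval hs = [seq tree_forest t | t <- ts].
  by rewrite mem_pmap_sub => /mapP[ts]; rewrite mem_permutations => ? ?; exists ts.
rewrite (fsbigE r); first last.
- move=> hs [hs0 hsE] hsr.
  (* An admissible tuple outside [r] has a factor that is not a tree, which puts a zero argument
     into the derivative. *)
  have [[ts tsE]|[g ghs ng]] := list_of_trees hs.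
    move: hsr; rewrite mem_pmap_sub /= tsE mem_map // mem_permutations => /negP[].
    have {hsE} <- : seq_mset ts = h by rewrite -prod_tree_forest -tsE.
    by rewrite perm_sym; apply: perm_eq_seq_mset.
  have Zg : Z g = 0.
    apply: Z0 => //; last by apply: contraNneq hs0 => <-.
    by apply: leq_trans hN; rewrite -hsE; apply: forest_size_factor.
  rewrite (symlin_has0 (symlin_totderiv (Z (unit_forest d)) Cphi (ltnW nN))) ?scaler0
    //.
    by rewrite size_map size_tuple.
  by rewrite -Zg map_f.
- move=> hs /= /rP[ts tsh tsE]; rewrite tsE; split.
    by apply/mapP => -[t _ /eqP]; rewrite eq_sym (negbTE (tree_forest_neq0 t)).
  rewrite prod_tree_forest -[RHS]seq_mset_id.
  exact/eq_seq_msetP.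
- by apply: pmap_sub_uniq; rewrite map_inj_uniq // permutations_uniq.
transitivity (\sum_(hs <- r) n`!%:R^-1 *: P).
  rewrite big_mkcond; apply: eq_big_seq => hs hsr.
  have [ts tsh tsE] := rP _ hsr.
  have hsA : hs \in [set hs : n.-tuple (forest d) | unit_forest d \notin (hs :
    seq (forest d)) /\
      \big[@msetD _/unit_forest d]_(g <- hs) g = h].
    rewrite inE /= tsE; split.
      by apply/mapP => -[t _ /eqP]; rewrite eq_sym (negbTE (tree_forest_neq0 t)).
    rewrite prod_tree_forest -[RHS]seq_mset_id.
    exact/eq_seq_msetP.
  rewrite hsA; congr (_ *: _).
  apply: (symlin_totderiv (Z (unit_forest d)) Cphi (ltnW nN)).1.
    by rewrite size_map size_tuple.
  by rewrite tsE -map_comp; apply: (perm_map (fun t => Z (tree_forest t)) tsh).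
rewrite big_const_seq count_predT iter_addr_0 size_pmap_sub count_map.
have permsz ts : ts \in permutations (h : seq (tree d)) -> size ts = size h.
  by rewrite mem_permutations => /perm_size.
case: eqP => [nE|nE]; last first.
  rewrite (@eq_in_count _ _ pred0) ?count_pred0 // => ts /permsz /= ts_sz.
  by rewrite size_map ts_sz eq_sym; apply/eqP.
rewrite (@eq_in_count _ _ predT) ?count_predT => [|ts /permsz /= ts_sz]; last first.
  by rewrite size_map ts_sz nE eqxx.
rewrite -scaler_nat scalerA nE -size_permutations_mset natrM invfM mulrA mulfV ?mul1r
  //.
rewrite pnatr_eq0 -lt0n.
by have := fact_gt0 (size h); rewrite -size_permutations_mset muln_gt0 => /andP[].
Qed.
End ComposedControlledPath.

(** * Sewing *)

Section Sewing.
Variables (R : realType) (V : normedModType R).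
Implicit Types (F : R -> R -> V) (s t u v : R) (P Q : seq R).

Definition partition_sum F s P : V := \sum_(uv <- zip (s :: P) P) F uv.1 uv.2.

Lemma partition_sum_cons F s v P : partition_sum F s (v ::
  P) = F s v + partition_sum F v P.
Proof. by rewrite /partition_sum /= big_cons. Qed.

Lemma partition_sum_cat F s P Q :
  partition_sum F s (P ++ Q) = partition_sum F s P + partition_sum F (last s P) Q.
Proof.
elim: P s => [|v P IH] s; first by rewrite {2}/partition_sum /= big_nil add0r.
by rewrite cat_cons !partition_sum_cons IH addrA.
Qed.

Definition mesh_lt (delta : R) s P : Prop :=
  forall uv, uv \in zip (s :: P) P -> uv.2 - uv.1 < delta.

Lemma mesh_lt_cat delta s P Q : mesh_lt delta s P -> mesh_lt delta (last s P) Q ->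
  mesh_lt delta s (P ++ Q).
Proof.
elim: P s => [//|v P IH] s H1 H2 uv; rewrite /= inE => /predU1P[->|uvP].
  by apply: H1; rewrite /= mem_head.
by apply: (IH v) uvP => // uv' uv'P; apply: H1; rewrite /= inE uv'P orbT.
Qed.

Fixpoint dyadic n s t : seq R :=
  if n is n'.+1 then dyadic n' s ((s + t) / 2) ++ dyadic n' ((s + t) / 2) t else [:: t].

Lemma midf_itv s t : s < t -> s < (s + t) / 2 /\ (s + t) / 2 < t.
Proof. by move=> st; split; lra. Qed.

Lemma dyadic_partition n s t : s < t -> itv_partition s t (dyadic n s t).
Proof.
elim: n s t => [|n IH] s t st; first by split; rewrite /= ?st.
have [sm mt] := midf_itv st.
exact: itv_partition_cat (IH _ _ sm) (IH _ _ mt).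
Qed.

Lemma dyadic_mesh n s t delta : s < t -> t - s < delta * 2 ^+ n ->
  mesh_lt delta s (dyadic n s t).
Proof.
elim: n s t => [|n IH] s t st.
  by rewrite expr0 mulr1 => H uv; rewrite /= inE => /eqP ->.
have [sm mt] := midf_itv st.
rewrite exprS mulrCA => H; apply: mesh_lt_cat; first by apply: IH => //; lra.
have [_ /eqP ->] := dyadic_partition n sm.
by apply: IH => //; lra.
Qed.

Variables t0 T : R.

(** In [sewing] this takes the place of constructing a limit: the sums of [F] along dyadic
    partitions are known to tend to 0. *)
Definition vanishing F : Prop := forall s t, t0 <= s -> s < t -> t <= T ->
  forall e : R, 0 < e -> exists2 delta : R, 0 < delta &
    forall P, itv_partition s t P -> mesh_lt delta s P -> `|partition_sum F s P| < e.

Lemma vanishingD F F' : vanishing F -> vanishing F' ->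
  vanishing (fun s t => F s t + F' s t).
Proof.
move=> H H' s t ts st tT e e0; have e20 : 0 < e / 2 by rewrite divr_gt0.
have [d1 d10 D1] := H s t ts st tT _ e20.
have [d2 d20 D2] := H' s t ts st tT _ e20.
exists (Num.min d1 d2); first by rewrite lt_min d10.
move=> P Pst mP; rewrite /partition_sum big_split (splitr e).
apply: le_lt_trans (ler_normD _ _) _; apply: ltrD.
  by apply: D1 => // uv /mP; rewrite lt_min => /andP[].
by apply: D2 => // uv /mP; rewrite lt_min => /andP[].
Qed.

Lemma path_le_last s P : path <%R s P -> s <= last s P.
Proof. by elim: P s => //= w P IH s /andP[sw wP];
  apply: le_trans (ltW sw) (IH _ wP). Qed.

Lemma mem_partition s P uv : path <%R s P -> uv \in zip (s :: P) P ->
  [/\ s <= uv.1, uv.1 < uv.2 & uv.2 <= last s P].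
Proof.
elim: P s => //= v P IH s /andP[sv vP];
  rewrite inE => /predU1P[->|/(IH _ vP)[vu uv12 uvl]].
  by split=> //=; apply: path_le_last.
by split=> //; apply: le_trans (ltW sv) vu.
Qed.

Lemma partition_sum_telescope (z : R -> V) s P :
  partition_sum (fun u v => z v - z u) s P = z (last s P) - z s.
Proof.
elim: P s => [|v Q IH] r; first by rewrite /partition_sum /= big_nil subrr.
by rewrite partition_sum_cons IH addrC subrKA.
Qed.

Lemma fine_partition (delta : R) s t : 0 < delta -> s < t ->
  exists2 P, itv_partition s t P & mesh_lt delta s P.
Proof.
move=> delta0 st; pose n := Num.truncn ((t - s) / delta).
exists (dyadic n.+1 s t); first exact: dyadic_partition.
apply: dyadic_mesh => //; rewrite mulrC -ltr_pdivrMr //;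
  apply: lt_le_trans (truncnS_gt _) _.
by rewrite -natrX ler_nat ltnW // ltn_expl.
Qed.

Lemma partition_sum_le F (L delta : R) s P : path <%R s P -> t0 <= s -> last s P <= T ->
  (forall u v, t0 <= u -> u < v -> v <= T -> v - u < delta -> `|F u v| <= L * (v - u))
    ->
  mesh_lt delta s P -> `|partition_sum F s P| <= L * (last s P - s).
Proof.
move=> + + + HF; elim: P s => [|v P IH] s.
  by rewrite /partition_sum /= big_nil normr0 subrr mulr0.
move=> /= /andP[sv vP] ts lT mP; rewrite partition_sum_cons.
apply: le_trans (ler_normD _ _) _.
have H1 : `|F s v| <= L * (v - s).
  apply: HF => //; first by apply: le_trans (path_le_last vP) lT.
  by apply: (mP (s, v)); rewrite /= mem_head.
have H2 : `|partition_sum F v P| <= L * (last v P - v).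
  apply: IH => //; first by apply: le_trans ts (ltW sv).
  by move=> uv uvP; apply: mP; rewrite /= inE uvP orbT.
lra.
Qed.

Lemma vanishing_powR F (C theta : R) : 1 < theta -> 0 <= C ->
  (forall s t, t0 <= s -> s < t -> t <= T -> `|F s t| <= C * (t - s) `^ theta) ->
  vanishing F.
Proof.
move=> theta1 C0 HF s t ts st tT e e0.
have th0 : 0 < theta - 1 by rewrite subr_gt0.
have ts0 : 0 < t - s by rewrite subr_gt0.
pose eta := e / ((C + 1) * (t - s)).
have eta0 : 0 < eta by rewrite divr_gt0 // mulr_gt0 // ltr_wpDl.
exists (eta `^ (theta - 1)^-1); first exact: powR_gt0.
move=> P [sP /eqP lP] mP.
apply: (@le_lt_trans _ _ (C * eta * (t - s))).
  rewrite -lP; apply: partition_sum_le mP => // [|u v tu uv vT vu]; first by rewrite lP.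
  have uv0 : 0 < v - u by rewrite subr_gt0.
  apply: le_trans (HF u v tu uv vT) _; rewrite -mulrA ler_wpM2l //.
  rewrite -(mulr_powRB1 (ltW uv0) (lt_trans ltr01 theta1)) mulrC ler_wpM2r ?(ltW uv0)
    //.
  have -> : eta = (eta `^ (theta - 1)^-1) `^ (theta - 1).
    by rewrite -powRrM mulVf ?gt_eqF // powRr1 // ltW.
  by apply: ge0_ler_powR; rewrite ?nnegrE ?powR_ge0 // ?ltW.
have -> : C * eta * (t - s) = e * (C / (C + 1)).
  by rewrite /eta; field; rewrite !gt_eqF // ltr_wpDl.
by rewrite gtr_pMr // ltr_pdivrMr ?mul1r ?ltrDl // ltr_wpDl.
Qed.

(** [rho] is 2^(1 - theta), the contraction gained by one bisection; it is below 1 because theta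
    exceeds 1. *)
Lemma half_powR (theta : R) : 1 < theta ->
  exists2 rho : R, 0 <= rho < 1 &
    forall x : R, 0 <= x -> 2 * (x / 2) `^ theta = rho * x `^ theta.
Proof.
move=> theta1; have th0 : 0 < theta by apply: lt_trans theta1.
exists ((2^-1) `^ (theta - 1)).
  have one : 1 `^ (theta - 1) = 1 :> R by rewrite powR1.
  rewrite powR_ge0 /= -[ltRHS]one.
  by apply: gt0_ltr_powR; rewrite ?subr_gt0 ?nnegrE ?invr_ge0 // invf_lt1 // ltr1n.
move=> x x0; rewrite powRM ?invr_ge0 // -(mulr_powRB1 (x := 2^-1)) ?invr_ge0 //.
by rewrite [x `^ _ * _]mulrC !mulrA mulfV ?mul1r // pnatr_eq0.
Qed.

Lemma sewing F (K theta : R) : 1 < theta -> 0 <= K ->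
  (forall s u t, t0 <= s -> s < u -> u < t -> t <= T ->
     `|F s t - F s u - F u t| <= K * (t - s) `^ theta) ->
  vanishing F ->
  exists2 K' : R, 0 <= K' &
    forall s t, t0 <= s -> s < t -> t <= T -> `|F s t| <= K' * (t - s) `^ theta.
Proof.
move=> theta1 K0 dF vF.
have [rho /andP[rho0 rho1] half] := half_powR theta1.
have rho1' : 0 < 1 - rho by rewrite subr_gt0.
(* The fixed point of C = C rho + K, that is, the sum of the geometric series of the errors over all
   bisections; it makes the bound [bnd] uniform in n. *)
pose C := K / (1 - rho).
have C0 : 0 <= C by rewrite divr_ge0 // ltW.
have CE : C * rho + K = C.
  by rewrite /C; field; rewrite gt_eqF.
exists C => // s t ts st tT; apply/ler_addgt0Pr => e e0.
have bnd n s' t' : t0 <= s' -> s' < t' -> t' <= T ->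
    `|partition_sum F s' (dyadic n s' t') - F s' t'| <= C * (t' - s') `^ theta.
  elim: n s' t' => [|n IH] s' t' ts' st' tT'.
    by rewrite /partition_sum /= big_seq1 subrr normr0 mulr_ge0 ?powR_ge0.
  have [sm mt] := midf_itv st'; set m := (s' + t') / 2 in sm mt *.
  have := IH _ _ ts' sm (le_trans (ltW mt) tT').
  have := IH _ _ (le_trans ts' (ltW sm)) mt tT'.
  have := dF _ _ _ ts' sm mt tT'.
  have -> : m - s' = (t' - s') / 2 by rewrite /m; lra.
  have -> : t' - m = (t' - s') / 2 by rewrite /m; lra.
  have := half (t' - s') (ltW (eqbRL (subr_gt0 _ _) st')).
  rewrite /= partition_sum_cat -/m.
  have [_ /eqP ->] := dyadic_partition n sm.
  set A := partition_sum _ s' _; set B := partition_sum _ m _.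
  set x := ((_ / 2) `^ _); set z := (_ `^ _) => xz H1 H2 H3.
  have -> : A + B - F s' t' = (A - F s' m) + (B - F m t') - (F s' t' - F s' m - F m t').
    by rewrite addrACA -opprD -(addrA (F s' t')) -opprD opprB addrA subrK.
  apply: le_trans (ler_normB _ _) _; apply: le_trans (lerD (ler_normD _ _) (lexx _)) _.
  rewrite -CE mulrDl -mulrA -xz; lra.
have [delta delta0 Hd] := vF s t ts st tT e e0.
pose n := Num.truncn ((t - s) / delta).
have nP : t - s < delta * 2 ^+ n.+1.
  rewrite mulrC -ltr_pdivrMr //; apply: lt_le_trans (truncnS_gt _) _.
  by rewrite -natrX ler_nat ltnW // ltn_expl.
have := Hd _ (dyadic_partition n.+1 st) (dyadic_mesh st nP).
have := bnd n.+1 s t ts st tT; set A := partition_sum _ _ _ => H1 H2.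
rewrite -[F s t](subKr A); apply: le_trans (ler_normB _ _) _.
by rewrite addrC; apply: lerD => //; apply: ltW.
Qed.

End Sewing.

(** * Orders of magnitude along a path *)

Section Orders.
Variables (R : realType) (alpha t0 T : R).
Hypothesis alpha_gt0 : 0 < alpha.

(** Natural powers of |u - s|^alpha make orders add like numbers of vertices; order 0 means bounded,
    which is also what truncated subtraction yields. *)
Definition bigO_pow (V : normedModType R) (r : nat) (E : R -> R -> V) : Prop :=
  exists2 C : R, 0 <= C & forall s u, t0 <= s -> s < u -> u <= T ->
    `|E s u| <= C * ((u - s) `^ alpha) ^+ r.

Local Notation bO := bigO_pow.

Lemma bO_eq (V : normedModType R) r (E E' : R -> R -> V) :
  (forall s u, t0 <= s -> s < u -> u <= T -> E s u = E' s u) -> bO r E -> bO r E'.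
Proof. by move=> EE' [C C0 H]; exists C => // s u ts su uT; rewrite -EE' //;
  apply: H. Qed.

Lemma bO_weak (V : normedModType R) r r' (E : R -> R -> V) :
  (r' <= r)%N -> bO r E -> bO r' E.
Proof.
move=> rr [C C0 H]; pose D := (T - t0) `^ alpha.
have D0 : 0 <= D by exact: powR_ge0.
exists (C * D ^+ (r - r')); first by rewrite mulr_ge0 ?exprn_ge0.
move=> s u ts su uT; apply: le_trans (H s u ts su uT) _.
rewrite -mulrA ler_wpM2l // -(subnK rr) exprD addnK ler_wpM2r ?exprn_ge0 ?powR_ge0 //.
apply: lerXn2r; rewrite ?nnegrE ?powR_ge0 //.
by apply: ge0_ler_powR; rewrite ?nnegrE ?(ltW alpha_gt0) //; lra.
Qed.

Lemma bO_cst (V : normedModType R) (E : R -> R -> V) (C : R) :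
  (forall s u, t0 <= s -> s < u -> u <= T -> `|E s u| <= C) -> bO 0 E.
Proof.
move=> H; exists `|C| => // s u ts su uT; rewrite expr0 mulr1.
exact: le_trans (H s u ts su uT) (ler_norm C).
Qed.

Lemma bO0 (V : normedModType R) r : bO r (fun _ _ => 0 : V).
Proof. by exists 0 => // s u _ _ _; rewrite normr0 mul0r. Qed.

Lemma bOD (V : normedModType R) r (E F : R -> R -> V) :
  bO r E -> bO r F -> bO r (fun s u => E s u + F s u).
Proof.
move=> [C C0 H] [D D0 K]; exists (C + D); first exact: addr_ge0.
move=> s u ts su uT; rewrite mulrDl; apply: le_trans (ler_normD _ _) _.
by apply: lerD; [apply: H|apply: K].
Qed.

Lemma bON (V : normedModType R) r (E : R -> R -> V) : bO r E -> bO r (fun s u =>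
  - E s u).
Proof. by move=> [C C0 H]; exists C => // s u ts su uT; rewrite normrN; apply: H. Qed.

Lemma bOB (V : normedModType R) r (E F : R -> R -> V) :
  bO r E -> bO r F -> bO r (fun s u => E s u - F s u).
Proof. by move=> HE /bON; apply: bOD. Qed.

Lemma bO_sum (V : normedModType R) (I : eqType) (l : seq I) (P : pred I) r (E :
  I -> R -> R -> V) :
  (forall i, i \in l -> P i -> bO r (E i)) -> bO r (fun s u =>
    \sum_(i <- l | P i) E i s u).
Proof.
elim: l => [|i l IH] H.
  by apply: bO_eq (bO0 V r) => s u _ _ _; rewrite big_nil.
have {}IH := IH (fun j jl => H j (mem_behead (s := i :: l) jl)).
have := H i (mem_head i l); case Pi: (P i) => Hi.
  by apply: bO_eq (bOD (Hi isT) IH) => s u _ _ _; rewrite big_cons Pi.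
by apply: bO_eq IH => s u _ _ _; rewrite big_cons Pi.
Qed.

Lemma bO_scale (V : normedModType R) r1 r2 (a : R -> R -> R) (E : R -> R -> V) :
  bO r1 a -> bO r2 E -> bO (r1 + r2) (fun s u => a s u *: E s u).
Proof.
move=> [C C0 H] [D D0 K]; exists (C * D); first exact: mulr_ge0.
move=> s u ts su uT; rewrite normrZ exprD mulrACA.
by apply: ler_pM => //; [apply: H|apply: K].
Qed.

Lemma bO_scalec (V : normedModType R) r (c : R) (E : R -> R -> V) :
  bO r E -> bO r (fun s u => c *: E s u).
Proof. by move=> HE; rewrite -[r]add0n; apply: bO_scale => //;
  apply: (@bO_cst _ _ `|c|). Qed.

Section MultilinearFamilies.
Variables (m : nat).
Local Notation V := 'rV[R]_m.

Definition bounded_symlin n (psi : R -> R -> seq V -> V) : Prop :=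
  (forall s u, symlin n (psi s u)) /\
  exists2 L : R, 0 <= L & forall s u, t0 <= s -> s < u -> u <= T ->
    forall vs, size vs = n -> `|psi s u vs| <= L * \prod_(v <- vs) `|v|.

Lemma bounded_symlin_cons n psi (F : R -> R -> V) : bounded_symlin n.+1 psi -> bO 0 F ->
  bounded_symlin n (fun s u vs => psi s u (F s u :: vs)).
Proof.
move=> [spsi [L L0 HL]] [C C0 HF]; split=> [s u|]; first exact: symlin_cons.
exists (L * C); first exact: mulr_ge0.
move=> s u ts su uT vs vsn.
apply: le_trans (HL s u ts su uT (F s u :: vs) _) _; first by rewrite /= vsn.
rewrite big_cons mulrA ler_wpM2r ?prodr_ge0 // ler_wpM2l //.
by have := HF s u ts su uT; rewrite expr0 mulr1.
Qed.

Lemma bO_prod_norm (K : eqType) (l : seq K) (r : K -> nat) (F : K -> R -> R -> V) :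
  (forall x, x \in l -> bO (r x) (F x)) ->
  exists2 C : R, 0 <= C & forall s u, t0 <= s -> s < u -> u <= T ->
    \prod_(x <- l) `|F x s u| <= C * ((u - s) `^ alpha) ^+ (\sum_(x <- l) r x)%N.
Proof.
elim: l => [|x l IH] HF.
  by exists 1 => // s u _ _ _; rewrite !big_nil mulr1.
have [C C0 HC] := IH (fun z zl => HF z (mem_behead (s := x :: l) zl)).
have [D D0 HD] := HF x (mem_head x l).
exists (D * C); first exact: mulr_ge0.
move=> s u ts su uT; rewrite !big_cons exprD mulrACA.
by apply: ler_pM => //; [apply: prodr_ge0|apply: HD|apply: HC].
Qed.

Lemma bO_symlin (K : eqType) n psi (l : seq K) (r : K -> nat) (F : K -> R -> R -> V) :
  bounded_symlin n psi -> size l = n -> (forall x, x \in l -> bO (r x) (F x)) ->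
  bO (\sum_(x <- l) r x)%N (fun s u => psi s u [seq F x s u | x <- l]).
Proof.
move=> [_ [L L0 HL]] ln /bO_prod_norm[C C0 HC].
exists (L * C); first exact: mulr_ge0.
move=> s u ts su uT; apply: le_trans (HL s u ts su uT _ _) _; first by rewrite size_map.
by rewrite big_map -mulrA ler_wpM2l //; apply: HC.
Qed.

Lemma bO_symlin_bounded (K : eqType) n psi (l : seq K) (F : K -> R -> R -> V) :
  bounded_symlin n psi -> size l = n -> (forall x, x \in l -> bO 0 (F x)) ->
  bO 0 (fun s u => psi s u [seq F x s u | x <- l]).
Proof.
by move=> Hpsi ln HF; have := bO_symlin (r := fun=> 0%N) Hpsi ln HF; rewrite big1.
Qed.

(** Arguments are replaced one at a time; each replacement leaves one difference of order r among
    bounded arguments. *)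
Lemma bO_symlin_diff (K : eqType) n psi (l : seq K) (F F' : K -> R -> R -> V) r :
  bounded_symlin n psi -> size l = n ->
  (forall x, x \in l -> [/\ bO 0 (F x), bO 0 (F' x) & bO r (fun s u =>
    F x s u - F' x s u)]) ->
  bO r (fun s u => psi s u [seq F x s u | x <- l] - psi s u [seq F' x s u | x <- l]).
Proof.
elim: n psi l => [|n IH] psi [|x l] //; first by move=> _ _ _;
  apply: bO_eq (bO0 V r) => s u _ _ _; rewrite subrr.
move=> Hpsi [ln] HF.
have [Fx F'x Dx] := HF x (mem_head x l).
have HF' z (zl : z \in l) := HF z (mem_behead (s := x :: l) zl).
have H2 := IH _ _ (bounded_symlin_cons Hpsi F'x) ln HF'.
(* [None] marks the slot of the difference, so that a single indexed family feeds [bO_symlin]. *)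
pose Hd := fun (o : option K) s u =>
  if o is Some z then F z s u else F x s u - F' x s u.
have H1 : bO r (fun s u => psi s u ((F x s u - F' x s u) :: [seq F z s u | z <- l])).
  have := @bO_symlin _ n.+1 psi (None :: map Some l) (fun o =>
    if o is Some _ then 0%N else r) Hd Hpsi.
  rewrite /= size_map ln big_cons big_map big1 // addn0 => /(_ erefl) H.
  apply: bO_eq (H _) => [s u _ _ _|[z|]]; first by rewrite -map_comp.
    by rewrite inE /= mem_map => [/HF'[]//|? ? []].
  by [].
apply: bO_eq (bOD H1 H2) => s u _ _ _ /=.
by rewrite (symlinB (Hpsi.1 s u)) ?size_map // addrA subrK.
Qed.

End MultilinearFamilies.
End Orders.

(** * Derivatives of the vector fields along the path *)

Section DifferentialsAlongPath.
Variables (R : realType) (alpha t0 T : R) (d m p : nat) (f :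
  'I_d -> 'rV[R]_m -> 'rV[R]_m).
Hypothesis Cf : forall i, cont_diff p (f i).
Local Notation V := 'rV[R]_m.
Local Notation bO := (bigO_pow alpha t0 T).
Variable (M : R).

Section BoundedPoint.
(** Instantiated at either endpoint, [y s] or [y u]. *)
Variable z : R -> R -> V.
Hypothesis zM : forall s u, t0 <= s -> s < u -> u <= T -> `|z s u| <= M.

Lemma bounded_totderiv i n : (n <= p)%N ->
  bounded_symlin t0 T n (fun s u vs => totderiv (f i) vs (z s u)).
Proof.
move=> np; split=> [s u|]; first exact: symlin_totderiv (Cf i) np.
have [L L0 HL] := totderiv_bound M (Cf i) np.
by exists L => // s u ts su uT; apply: HL; apply: zM.
Qed.

Lemma bO_bcoef t : (tree_size t <= p)%N -> bO 0 (fun s u => bcoef f t (z s u)).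
Proof.
elim/tree_bplus_ind: t => i h IH; rewrite tree_size_bplus => hp.
have hsz : (size h <= p)%N by apply: leq_trans (forest_size_ge h) (ltnW hp).
have H : bO 0 (fun s u => (mfact h)%:R^-1 *:
    totderiv (f i) [seq bcoef f t (z s u) | t <- (h : forest d)] (z s u)).
  apply: bO_scalec.
  apply: (bO_symlin_bounded (F := fun t s u =>
    bcoef f t (z s u)) (bounded_totderiv i hsz)) => //.
  move=> t th; apply: IH => //.
  by apply: leq_trans (ltnW hp); apply: forest_size_mem.
by apply: bO_eq H => s u _ _ _; rewrite (bcoef_bplus Cf).
Qed.

End BoundedPoint.

Variable y : R -> V.
Hypothesis yM : forall t, t0 <= t -> t <= T -> `|y t| <= M.
Hypothesis ylip : bO 1 (fun s u => y u - y s).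

(** [size l] derivatives are already spent, so q - [size l] remain; the remainder contains that many
    factors [y u - y s], each of order 1. *)
Lemma bO_taylor (K : eqType) i q (l : seq K) (c : K -> R -> R -> V) :
  (q <= p)%N -> (size l <= q)%N -> (forall x, x \in l -> bO 0 (c x)) ->
  bO (q - size l) (fun s u => totderiv (f i) [seq c x s u | x <- l] (y u) -
    \sum_(j < q - size l) j`!%:R^-1 *:
      totderiv (f i) (nseq j (y u - y s) ++ [seq c x s u | x <- l]) (y s)).
Proof.
move=> qp lq Hc; set k := size l in lq *.
have [L L0 HL] := totderiv_bound M (Cf i) qp.
pose F (o : option K) s u := if o is Some x then c x s u else y u - y s.
pose l' := nseq (q - k) None ++ [seq Some x | x <- l].
have Fl' x : x \in l' -> bO (if x is Some _ then 0%N else 1%N) (F x).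
  by rewrite mem_cat => /orP[/nseqP[-> _]|/mapP[w wl ->]] //; apply: Hc.
have [C C0 HC] := bO_prod_norm Fl'.
have rE : (\sum_(x <- l') (if x is Some _ then 0%N else 1%N) = q - k)%N.
  by rewrite big_cat /= big_map [X in (_ + X)%N]big1 // big_nseq /= addn0 iter_addn_0
    mul1n.
have l'E s u (v := y u - y s) : [seq F x s u | x <- l'] = nseq (q - k) v ++ [seq c x s
  u | x <- l].
  by rewrite map_cat map_nseq -map_comp.
exists (L * C); first exact: mulr_ge0.
move=> s u ts su uT; have ut := le_trans ts (ltW su); have sT := le_trans (ltW su) uT.
have := HC s u ts su uT; rewrite rE => HC'.
have [v Ev] : {v | v = y u - y s} by eexists.
have yuE : y u = y s + v by rewrite Ev addrC subrK.
have [cs Ecs] : {cs | cs = [seq c x s u | x <- l]} by eexists.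
have szcs : size cs = k by rewrite Ecs size_map.
have CC : cont_diff (q - k) (totderiv (f i) cs).
  by apply: cont_diff_totderiv (Cf i) _ _; rewrite szcs subnK.
have B0 : 0 <= L * (C * ((u - s) `^ alpha) ^+ (q - k)).
  by rewrite !mulr_ge0 ?exprn_ge0 ?powR_ge0.
rewrite -mulrA -Ecs -Ev yuE.
have Eq j : totderiv (f i) (nseq j v ++ cs) = totderiv (totderiv (f i) cs) (nseq j v).
  exact: totderiv_cat.
under eq_bigr => j _ do rewrite Eq.
apply: (taylor_totderiv CC B0) => r /andP[r0 r1].
rewrite -Eq; apply: le_trans (HL _ _ _ _) _.
(* By convexity the segment from [y s] to [y u] stays in the ball of radius [M], where the
   derivatives are bounded. *)
- have -> : y s + r *: v = (1 - r) *: y s + r *: y u.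
    by rewrite Ev scalerBr scalerBl scale1r addrA addrAC.
  apply: le_trans (ler_normD _ _) _; rewrite !normrZ (ger0_norm r0) ger0_norm
    ?subr_ge0 //.
  have := yM ts sT; have := yM ut uT => H1 H2.
  have H3 : (1 - r) * `|y s| <= (1 - r) * M by rewrite ler_wpM2l ?subr_ge0.
  have H4 : r * `|y u| <= r * M by rewrite ler_wpM2l.
  lra.
- by rewrite size_cat size_nseq szcs subnK.
- rewrite ler_wpM2l // Ev Ecs -l'E big_map; exact: HC'.
Qed.

End DifferentialsAlongPath.

(** * Re-expansion at another base point *)

(** A forest with at most n vertices has at most n trees, each of at most n vertices, so grouping by
    number of trees reaches all of them. *)
Lemma sum_msets_forests_le (d n : nat) (U : nmodType) (Phi : forest d -> U) :
  \sum_(k < n.+1) \sum_(h <- msets (trees_le d n.+1) k | (forest_size h <= n)%N) Phi h =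
  \sum_(h <- forests_le d n) Phi h.
Proof.
transitivity (\sum_(k < n.+1) \sum_(h <- forests_le d n | size (h :
  forest d) == k) Phi h).
  apply: eq_bigr => k _; rewrite -big_filter -[RHS]big_filter.
  apply: perm_big; apply: uniq_perm; rewrite ?filter_uniq ?fset_uniq // => h.
  rewrite !mem_filter forests_leP [RHS]andbC; case: (leqP (forest_size h) n) => hn //=.
  apply/msetsP/eqP => [[]//|hk]; split=> // t th; rewrite trees_leP.
  by apply: leq_trans (forest_size_mem th) (leqW hn).
rewrite (exchange_big_dep xpredT) //=; apply: eq_big_seq => h;
  rewrite forests_leP => hn.
have hs : (size (h : forest d) < n.+1)%N by rewrite ltnS (leq_trans (forest_size_ge h)).
by rewrite (big_pred1 (Ordinal hs)) // => k; rewrite /= -val_eqE /= eq_sym.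
Qed.

Section ChangeOfBasePoint.
Variables (R : realType) (alpha t0 T : R) (d m p : nat) (f :
  'I_d -> 'rV[R]_m -> 'rV[R]_m).
Hypothesis alpha_gt0 : 0 < alpha.
Hypothesis Cf : forall i, cont_diff p (f i).
Local Notation V := 'rV[R]_m.
Local Notation bO := (bigO_pow alpha t0 T).
Variable X : R -> R -> hdual R d.
Hypothesis Xchar : forall s u, t0 <= s -> s < u -> u <= T -> character (X s u).
Hypothesis Xtree : forall t, bO (tree_size t) (fun s u => X s u (tree_forest t)).

Lemma bO_forest h : bO (forest_size h) (fun s u => X s u h).
Proof.
move: {2}(size h) (erefl (size h)) => n; elim: n h => [|n IH] h hn.
  have -> : h = unit_forest d by apply/eqP; rewrite -size_mset_eq0 hn.
  rewrite forest_size0; apply: (@bO_cst _ _ _ _ _ _ 1) => s u ts su uT.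
  by rewrite (Xchar ts su uT).1 normr1.
have [h0|[t th]] := mset_0Vmem h; first by rewrite h0 size_mset0 in hn.
rewrite -(msetB1K th) forest_size_cons.
have gn : size (msetB h (msetn 1 t)) = n.
  by move: hn; rewrite -{1}(msetB1K th) size_mset_cons => -[].
apply: bO_eq (bO_scale (Xtree t) (IH _ gn)) => s u ts su uT.
by rewrite (Xchar ts su uT).2.
Qed.

Lemma bO_cop_coef h g : bO (forest_size h - forest_size g) (fun s u =>
  cop_coef (X s u) h g).
Proof.
apply: bO_sum => q qh /eqP <-; rewrite -(cop_size qh) addnK; exact: bO_forest.
Qed.

Lemma bO_cop_tcoef t s : bO (tree_size t - tree_size s) (fun r u =>
  cop_tcoef (X r u) t s).
Proof.
apply: bO_sum => q qt /eqP qs; rewrite -(cop_tree_size qt) qs forest_size_tree addnK.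
exact: bO_forest.
Qed.

Variables (M : R) (y : R -> V).
Hypothesis yM : forall t, t0 <= t -> t <= T -> `|y t| <= M.
Hypothesis ylip : bO 1 (fun s u => y u - y s).
Variable q : nat.
Hypothesis q_gt0 : (0 < q)%N.
Hypothesis qp : (q <= p)%N.

Definition bseries s u : V :=
  \sum_(t <- trees_le d q) X s u (tree_forest t) *: bcoef f t (y s).

(* The coefficient c_tau of the header comment. *)
Definition shifted_coef tau s u : V :=
  \sum_(t <- trees_le d q) cop_tcoef (X s u) t tau *: bcoef f t (y s).

Hypothesis y_expansion : bO q (fun s u => y u - y s - bseries s u).

Let bO_G t : (tree_size t <= q)%N -> bO 0 (fun s u => bcoef f t (y s)).
Proof.
move=> tq; apply: (bO_bcoef alpha Cf (z := fun s u => y s) (M := M));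
  last exact: leq_trans tq qp.
by move=> s u ts su uT; apply: yM => //; apply: le_trans (ltW su) uT.
Qed.

Lemma bO_bseries : bO 1 bseries.
Proof.
apply: bO_sum => t; rewrite trees_leP => tq _.
apply: (@bO_weak _ _ _ _ alpha_gt0 _ (tree_size t + 0)).
  by rewrite addn0 tree_size_gt0.
by apply: bO_scale (Xtree t) (bO_G tq).
Qed.

Lemma bO_shifted_coef tau : bO 0 (shifted_coef tau).
Proof.
apply: bO_sum => t; rewrite trees_leP => tq _.
apply: (@bO_weak _ _ _ _ alpha_gt0 _ (tree_size t - tree_size tau + 0)) => //.
exact: bO_scale (bO_cop_tcoef t tau) (bO_G tq).
Qed.

(** A term of Delta t whose second factor is a tree keeps the root label of t there, so only trees
    with root i contribute. *)
Lemma shifted_coef_bplus i g s u :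
  shifted_coef (bplus i g) s u =
  \sum_(h <- forests_le d q.-1) (mfact h)%:R^-1 *:
    (cop_coef (X s u) h g *: totderiv (f i) [seq bcoef f t (y s) | t <- (h :
      forest d)] (y s)).
Proof.
rewrite /shifted_coef -{1}(prednK q_gt0) sum_trees_le (bigD1 i) //= addrC big1 ?add0r.
  apply: eq_big_seq => h; rewrite forests_leP => hq.
  rewrite cop_tcoef_bplus eqxx (bcoef_bplus Cf); first by rewrite !scalerA mulrC.
  by apply: leq_trans (forest_size_ge h) (leq_trans hq (leq_trans (leq_pred _) qp)).
move=> j ji; apply: big1 => h _; rewrite cop_tcoef_bplus eq_sym (negbTE ji).
by rewrite scale0r.
Qed.

Lemma change_of_base_point tau : (tree_size tau <= q)%N ->
  bO (q.+1 - tree_size tau) (fun s u => bcoef f tau (y u) - shifted_coef tau s u).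
Proof.
elim/tree_bplus_ind: tau => i g IH; rewrite tree_size_bplus subSS => gq.
set k := size g; set r := (q - forest_size g)%N.
have kg : (k <= forest_size g)%N by exact: forest_size_ge.
have kq : (k <= q)%N by apply: leq_trans kg (ltnW gq).
have kp := leq_trans kq qp.
pose C0 := bseries; pose C1 := shifted_coef.
have ysM s u : t0 <= s -> s < u -> u <= T -> `|y s| <= M.
  by move=> ts su uT; apply: yM => //; apply: le_trans (ltW su) uT.
have yuM s u : t0 <= s -> s < u -> u <= T -> `|y u| <= M.
  by move=> ts su uT; apply: yM => //; apply: le_trans ts (ltW su).
have bTDs n : (n <= p)%N -> bounded_symlin t0 T n (fun s u l => totderiv (f i) l (y s)).
  by move=> np; apply: bounded_totderiv Cf _ _ ysM _ _ np.
have bTDu n : (n <= p)%N -> bounded_symlin t0 T n (fun s u l => totderiv (f i) l (y u)).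
  by move=> np; apply: bounded_totderiv Cf _ _ yuM _ _ np.
have weak := @bO_weak R alpha t0 T alpha_gt0 V.
(* Induction hypothesis: the branches are replaced by their shifted coefficients, with error of
   order q + 1 - |t|, at least [r] because |t| <= |g|. *)
have S1 : bO r (fun s u => totderiv (f i) [seq bcoef f t (y u) | t <- (g :
  forest d)] (y u) -
    totderiv (f i) [seq C1 t s u | t <- (g : forest d)] (y u)).
  apply: (bO_symlin_diff (F := fun t s u =>
    bcoef f t (y u)) (F' := C1) (bTDu _ kp) (erefl _)).
  move=> t tg; have tsz : (tree_size t <= forest_size g)%N by apply: forest_size_mem.
  have tq : (tree_size t <= q)%N by apply: leq_trans tsz (ltnW gq).
  split; last 2 first; first exact: bO_shifted_coef.
    by apply: weak (IH t tg tq); rewrite /r leq_sub // leqW.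
  by apply: (bO_bcoef alpha Cf yuM); apply: leq_trans tq qp.
have S2 : bO r (fun s u => totderiv (f i) [seq C1 t s u | t <- (g : forest d)] (y u) -
    \sum_(j < q - k) j`!%:R^-1 *:
      totderiv (f i) (nseq j (y u - y s) ++ [seq C1 t s u | t <- (g :
        forest d)]) (y s)).
  apply: (@weak (q - k)%N); first by rewrite /r leq_sub2l.
  apply: (bO_taylor Cf yM ylip i qp kq) => t _; exact: bO_shifted_coef.
pose A4 s u := \sum_(j < q - k) j`!%:R^-1 *:
      totderiv (f i) (nseq j (C0 s u) ++ [seq C1 t s u | t <- (g : forest d)]) (y s).
(* After the Taylor expansion at [y s], each increment of [y] is replaced by the series, with error
   of order q >= [r]. *)
have S3 : bO r (fun s u => (\sum_(j < q - k) j`!%:R^-1 *: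
      totderiv (f i) (nseq j (y u - y s) ++ [seq C1 t s u | t <- (g : forest d)]) (y s))
    - A4 s u).
  pose F v (o : option (tree d)) s u := if o is Some t then C1 t s u else v s u : V.
  pose v s u := y u - y s.
  pose l j := nseq j None ++ [seq Some t | t <- (g : seq (tree d))].
  have lE w j s u : [seq F w x s u | x <- l j] =
      nseq j (w s u) ++ [seq C1 t s u | t <- (g : forest d)].
    by rewrite map_cat map_nseq -map_comp.
  have H j : (j < q - k)%N -> bO r (fun s u =>
    totderiv (f i) [seq F v x s u | x <- l j] (y s)
      - totderiv (f i) [seq F C0 x s u | x <- l j] (y s)).
    move=> jq; have szl : size (l j) = (j + k)%N by rewrite size_cat size_nseq size_map.
    have jkp : (j + k <= p)%N by lia.
    apply: (bO_symlin_diff (bTDs _ jkp) szl) => -[t|] _; split=> /=.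
    - exact: bO_shifted_coef.
    - exact: bO_shifted_coef.
    - by apply: bO_eq (bO0 _ _ _ _ r) => s u _ _ _; rewrite subrr.
    - exact: weak ylip.
    - exact: weak bO_bseries.
    - by apply: weak y_expansion; rewrite /r leq_subr.
  apply: bO_eq (bO_sum (l := index_enum 'I_(q - k)) (P := xpredT)
    (fun (j : 'I_(q - k)) _ _ => bO_scalec j`!%:R^-1 (H j (ltn_ord j)))) => s u _ _ _.
  rewrite /A4 -sumrB; apply: eq_bigr => j _.
  by rewrite !lE scalerBr.
pose Phi s u (h : forest d) : V := (mfact h)%:R^-1 *:
    (cop_coef (X s u) h g *: totderiv (f i) [seq bcoef f t (y s) | t <- (h :
      forest d)] (y s)).
(* The exponential identity turns the forests with n trees into the Taylor term j = n - k; for n < k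
   the weight [invfact] is 0. *)
have S4 s u : t0 <= s -> s < u -> u <= T ->
    (mfact g)%:R^-1 *: A4 s u = \sum_(n < q) \sum_(h <- msets (trees_le d q) n) Phi s
      u h.
  move=> ts su uT.
  have E n : (n < q)%N -> \sum_(h <- msets (trees_le d q) n) Phi s u h =
     (invfact R n k / (mfact g)%:R) *:
        totderiv (f i) (nseq (n - k) (C0 s u) ++ [seq C1 t s u | t <- (g :
          forest d)]) (y s).
    move=> nq; have np : (n <= p)%N by lia.
    exact: (mset_exponential (trees_le d q) (fun t => bcoef f t (y s))
      (fun g => cop_coef0 g (Xchar ts su uT)) (fun t h g =>
        cop_coef_cons t h g (Xchar ts su uT))
      g (symlin_totderiv (y s) (Cf i) np)).
  under [RHS]eq_bigr => n _ do rewrite E //.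
  rewrite /A4 scaler_sumr.
  rewrite -(big_mkord xpredT (fun n => (invfact R n k / (mfact g)%:R) *:
        totderiv (f i) (nseq (n - k) (C0 s u) ++ [seq C1 t s u | t <- (g :
          forest d)]) (y s))).
  rewrite (big_cat_nat (n := k)) //= big_nat [X in _ = X + _]big1 => [|n /andP[_ nk]];
    last first.
    by rewrite /invfact leqNgt nk mul0r scale0r.
  rewrite add0r -[X in \sum_(X <= _ < _) _]add0n big_addn big_mkord;
    apply: eq_bigr => j _.
  by rewrite addnK /invfact leq_addl addnK scalerA mulrC.
(* Forests with fewer than q trees but at least q vertices: their coefficient has order |h| - |g|,
   hence at least [r]. *)
pose rest s u := \sum_(n < q)
  \sum_(h <- msets (trees_le d q) n | ~~ (forest_size h <= q.-1)%N) Phi s u h.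
have S5 s u : \sum_(n < q) \sum_(h <- msets (trees_le d q) n) Phi s u h =
    shifted_coef (bplus i g) s u + rest s u.
  rewrite shifted_coef_bplus -sum_msets_forests_le prednK // -big_split /=.
  by apply: eq_bigr => n _; rewrite (bigID (fun h => (forest_size h <= q.-1)%N)).
have S6 : bO r rest.
  apply: (bO_sum (l := index_enum 'I_q)) => n _ _.
  apply: bO_sum => h /msetsP[hn hq]; rewrite -ltnNge prednK // => qh.
  apply: bO_scalec.
  apply: (@weak (forest_size h - forest_size g + 0)%N).
    by rewrite addn0 /r leq_sub2r // -ltnS -(prednK q_gt0).
  apply: bO_scale; first exact: bO_cop_coef.
  have hp : (size (h : forest d) <= p)%N by rewrite hn;
    apply: leq_trans (ltnW (ltn_ord n)) qp.
  apply: (bO_symlin_bounded (F := fun t s u => bcoef f t (y s)) (bTDs _ hp)) =>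
    // t /hq.
  by rewrite trees_leP => /bO_G.
have := bOD (bO_scalec (mfact g)%:R^-1 (bOD (bOD S1 S2) S3)) S6.
apply: bO_eq => s u ts su uT.
rewrite !subrKA scalerBr S4 // S5 (bcoef_bplus Cf _ _ kp).
by rewrite opprD addrA subrK.
Qed.

End ChangeOfBasePoint.

(** * Raising the order of the expansion *)

Section LocalExpansion.
Variables (R : realType) (alpha t0 T : R) (d m p : nat) (f :
  'I_d -> 'rV[R]_m -> 'rV[R]_m).
Hypothesis alpha_gt0 : 0 < alpha.
Hypothesis Cf : forall i, cont_diff p (f i).
Local Notation V := 'rV[R]_m.
Local Notation bO := (bigO_pow alpha t0 T).
Variable X : R -> R -> hdual R d.
Hypothesis Xchar : forall s u, t0 <= s -> s < u -> u <= T -> character (X s u).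
Hypothesis Xtree : forall t, bO (tree_size t) (fun s u => X s u (tree_forest t)).
Hypothesis chen : forall s u t, t0 <= s -> s < u -> u < t -> t <= T ->
  X s t = hstar (X s u) (X u t).
Variables (M : R) (y : R -> V).
Hypothesis yM : forall t, t0 <= t -> t <= T -> `|y t| <= M.
Hypothesis ylip : bO 1 (fun s u => y u - y s).

Local Notation Xi q := (bseries f X y q).
Local Notation shifted q := (shifted_coef f X y q).

Lemma bseries_increment q s u t : t0 <= s -> s < u -> u < t -> t <= T ->
  Xi q s t - Xi q s u - Xi q u t =
  \sum_(tau <- trees_le d q) X u t (tree_forest tau) *:
     (shifted q tau s u - bcoef f tau (y u)).
Proof.
move=> ts su ut tT; have [Xut1 _] := Xchar (le_trans ts (ltW su)) ut tT.
under [RHS]eq_bigr => tau _ do rewrite scalerBr.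
rewrite sumrB; congr (_ - _); rewrite /bseries -sumrB.
under [RHS]eq_bigr => tau _ do rewrite /shifted_coef scaler_sumr.
rewrite [RHS]exchange_big /=; apply: eq_big_seq => tau; rewrite trees_leP => tauq.
under [RHS]eq_bigr => tau' _ do rewrite scalerA.
rewrite -scalerBl -scaler_suml; congr (_ *: _).
rewrite (chen ts su ut tT) /hstar.
rewrite (sum_cop_tree_forest tau (fun x z => X s u x * X u t z)).
(* The term tau (x) 1 of the coproduct cancels the contribution of tau to [Xi q s u]; the other
   second factors are trees, by which the sum is regrouped. *)
rewrite (sum_cop_tree tau (fun x z => X s u x * X u t z)) Xut1 mulr1 addrAC subrr add0r.
under [RHS]eq_bigr => tau' _ do rewrite cop_tcoefE mulr_sumr.
rewrite [RHS]exchange_big /=; apply: eq_big_seq => r rb.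
set s' := bplus _ _.
have s'q : s' \in trees_le d q.
  rewrite trees_leP tree_size_bplus (leq_trans _ tauq) //.
  rewrite -(bplus_tree_branches tau) tree_size_bplus ltnS.
  by rewrite -(cop_size rb) leq_addl.
transitivity (\sum_(x <- trees_le d q) if x == s' then X s u r.1 * X u t (tree_forest
  s') else 0).
  by rewrite sum_pred1_seq ?fset_uniq // s'q.
by apply: eq_bigr => x _; case: eqP => [->|]; rewrite ?mulr0 // mulrC.
Qed.

Lemma sum_three_point_bound (I : eqType) (l : seq I) (E : I -> R -> R -> R -> V) (g :
  R -> R -> R) :
  (forall i, i \in l -> exists2 C : R, 0 <= C &
     forall s u t, t0 <= s -> s < u -> u < t -> t <= T -> `|E i s u t| <= C * g s t) ->
  exists2 C : R, 0 <= C &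
     forall s u t, t0 <= s -> s < u -> u < t -> t <= T ->
       `|\sum_(i <- l) E i s u t| <= C * g s t.
Proof.
elim: l => [|i l IH] H.
  by exists 0 => // s u t *; rewrite big_nil normr0 mul0r.
have [C C0 HC] := IH (fun j jl => H j (mem_behead (s := i :: l) jl)).
have [D D0 HD] := H i (mem_head i l).
exists (D + C); first exact: addr_ge0.
move=> s u t ts su ut tT; rewrite big_cons mulrDl; apply: le_trans (ler_normD _ _) _.
by apply: lerD; [apply: HD|apply: HC].
Qed.

Lemma bseries_increment_bound q : (0 < q)%N -> (q <= p)%N ->
  bO q (fun s u => y u - y s - Xi q s u) ->
  exists2 K : R, 0 <= K &
    forall s u t, t0 <= s -> s < u -> u < t -> t <= T ->
     `|Xi q s t - Xi q s u - Xi q u t| <= K * ((t - s) `^ alpha) ^+ q.+1.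
Proof.
move=> q0 qp Bq.
have [|K K0 HK] := @sum_three_point_bound _ (trees_le d q)
  (fun tau s u t => X u t (tree_forest tau) *: (shifted q tau s u - bcoef f tau (y u)))
  (fun s t => ((t - s) `^ alpha) ^+ q.+1).
  move=> tau; rewrite trees_leP => tauq.
  have [C C0 HC] := Xtree tau.
  have [D D0 HD] := change_of_base_point alpha_gt0 Cf Xchar Xtree yM ylip q0 qp Bq tauq.
  exists (C * D); first exact: mulr_ge0.
  move=> s u t ts su ut tT; rewrite normrZ distrC.
  have tu : t0 <= u := le_trans ts (ltW su).
  have uT : u <= T := le_trans (ltW ut) tT.
  apply: (@le_trans _ _ ((C * ((t - s) `^ alpha) ^+ tree_size tau) *
                         (D * ((t - s) `^ alpha) ^+ (q.+1 - tree_size tau)))).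
    apply: ler_pM => //.
      apply: le_trans (HC u t tu ut tT) _; rewrite ler_wpM2l //.
      apply: lerXn2r; rewrite ?nnegrE ?powR_ge0 //.
      by apply: ge0_ler_powR; rewrite ?nnegrE ?(ltW alpha_gt0) //; lra.
    apply: le_trans (HD s u ts su uT) _; rewrite ler_wpM2l //.
    apply: lerXn2r; rewrite ?nnegrE ?powR_ge0 //.
    by apply: ge0_ler_powR; rewrite ?nnegrE ?(ltW alpha_gt0) //; lra.
  by rewrite mulrACA -exprD subnKC // leqW.
exists K => // s u t ts su ut tT; rewrite bseries_increment //.
exact: HK.
Qed.

Lemma bO_bseries_diff q q' : (q <= q')%N -> (q' <= p)%N ->
  bO q.+1 (fun s u => Xi q' s u - Xi q s u).
Proof.
move=> qq' q'p.
have H : bO q.+1 (fun s u => \sum_(t <- trees_le d q' | ~~ (tree_size t <= q)%N)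
    X s u (tree_forest t) *: bcoef f t (y s)).
  apply: bO_sum => t; rewrite trees_leP -ltnNge => tq' qt.
  apply: (@bO_weak _ _ _ _ alpha_gt0 _ (tree_size t + 0)); first by rewrite addn0.
  apply: bO_scale (Xtree t) _.
  apply: (bO_bcoef alpha Cf (z := fun s u => y s) (M := M));
    last exact: leq_trans tq' q'p.
  by move=> s u ts su uT; apply: yM => //; apply: le_trans (ltW su) uT.
apply: bO_eq H => s u _ _ _; rewrite /bseries.
rewrite [X in _ = X - _](bigID (fun t => (tree_size t <= q)%N)) /= addrAC.
rewrite -big_filter [X in _ = X - _ + _](_ :
  _ = \sum_(t <- trees_le d q) X s u (tree_forest t) *: bcoef f t (y s)).
  by rewrite subrr add0r big_filter.
rewrite -big_filter; apply: perm_big; apply: uniq_perm;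
  rewrite ?filter_uniq ?fset_uniq // => t.
rewrite mem_filter !trees_leP; case: leqP => //= tq; exact: leq_trans tq qq'.
Qed.

Lemma powR_expn (x : R) n : 0 <= x -> (x `^ alpha) ^+ n = x `^ (alpha * n%:R).
Proof. by move=> x0; rewrite powRrM powR_mulrn // powR_ge0. Qed.

Variable N : nat.
Hypothesis N_gt0 : (0 < N)%N.
Hypothesis N_large : 1 < alpha * N.+1%:R.
Hypothesis base : bO N (fun s u => y u - y s - Xi N s u).
Hypothesis vanish : vanishing t0 T (fun s u => y u - y s - Xi N s u).

Lemma local_expansion q : (N <= q)%N -> (q <= p)%N ->
  bO q.+1 (fun s u => y u - y s - Xi q s u).
Proof.
have step r : (N <= r)%N -> (r <= p)%N -> bO r (fun s u => y u - y s - Xi r s u) ->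
    bO r.+1 (fun s u => y u - y s - Xi r s u).
  move=> Nr rp Br; have r0 := leq_trans N_gt0 Nr.
  have [K K0 HK] := bseries_increment_bound r0 rp Br.
  pose theta := alpha * r.+1%:R.
  have theta1 : 1 < theta.
    by apply: lt_le_trans N_large _; rewrite ler_wpM2l ?ler_nat ?(ltW alpha_gt0).
  (* Xi^r - Xi^N has order N + 1, an exponent above 1, so its sums over fine partitions vanish as
     well. *)
  have van : vanishing t0 T (fun s u => y u - y s - Xi r s u).
    have [C C0 HC] := bO_bseries_diff Nr rp.
    have v2 : vanishing t0 T (fun s u => - (Xi r s u - Xi N s u)).
      apply: (@vanishing_powR _ _ _ _ _ C _ N_large C0) => s t ts st tT.
      by rewrite normrN -powR_expn ?HC //; lra.
    move=> s t ts st tT e e0; have [dl dl0 Hdl] := vanishingD vanish v2 ts st tT e0.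
    exists dl => // P Pst mP; have := Hdl P Pst mP; congr (`|_| < _).
    by apply: eq_bigr => uv _; rewrite opprB subrKA.
  (* The increments of [y] cancel, leaving minus the three-point difference of the series. *)
  have dF s u t : t0 <= s -> s < u -> u < t -> t <= T ->
     `|(y t - y s - Xi r s t) - (y u - y s - Xi r s u) - (y t - y u - Xi r u t)|
       <= K * (t - s) `^ theta.
    move=> ts su ut tT; rewrite -powR_expn; last by lra.
    rewrite -normrN; apply: le_trans (HK s u t ts su ut tT); rewrite le_eqVlt;
      apply/orP; left.
    apply/eqP; congr `|_|; apply/rowP => j; rewrite !mxE; ring.
  have [K' K'0 HK'] := sewing theta1 K0 dF van.
  exists K' => // s u ts su uT; rewrite powR_expn; last by lra.
  exact: HK'.
elim: q => [|q IH]; first by rewrite leqNgt N_gt0.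
rewrite leq_eqVlt => /predU1P[NE|]; first by move=> qp; apply: step; rewrite ?NE // -NE.
rewrite ltnS => Nq qp; apply: step => //; first exact: leqW.
(* Adding the trees with q + 1 vertices changes the remainder by order q + 1 only, which yields the
   hypothesis of [step] at q + 1. *)
have := bOB (IH Nq (ltnW qp)) (bO_bseries_diff (leqnSn q) qp).
by apply: bO_eq => s u _ _ _; rewrite opprB subrKA.
Qed.

End LocalExpansion.

(** * Solutions of the rough differential equation *)

Section Solutions.
Variables (R : realType) (d m : nat) (alpha T t0 : R) (p : nat)
    (X : R -> R -> hdual R d) (f : 'I_d -> 'rV[R]_m -> 'rV[R]_m).
Hypothesis alpha_gt0 : 0 < alpha.
Hypothesis alpha_le1 : alpha <= 1.
Hypothesis HX : branched_rough_path alpha T X.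
Hypothesis Hp : (level alpha <= p)%N.
Hypothesis Cf : forall i, cont_diff p (f i).
Hypothesis t0_ge0 : 0 <= t0.
Local Notation V := 'rV[R]_m.
Local Notation N := (level alpha).

Lemma level_gt0 : (0 < N)%N.
Proof. by rewrite truncn_gt0 invf_ge1. Qed.

Lemma level_large : 1 < alpha * N.+1%:R.
Proof. by rewrite -ltr_pdivrMl // mulr1 truncnS_gt. Qed.

Lemma cont_diff_level i : cont_diff N (f i).
Proof. by apply: (cont_diff_totderiv (ws := [::]) (Cf i)); rewrite addn0. Qed.

Lemma dom_mem t : t0 <= t -> t <= T -> t \in `[0, T].
Proof. by move=> t0t tT; rewrite in_itv /= tT (le_trans t0_ge0). Qed.

(* Multiplicativity and Chen's relation also hold for X = 0, for which the
   empty forest is mapped to 0 instead of 1. *)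
Lemma unit_dichotomy :
  (forall s t, s \in `[0, T] -> t \in `[0, T] -> X s t (unit_forest d) = 1) \/
  (forall s t, s \in `[0, T] -> t \in `[0, T] -> forall h, X s t h = 0).
Proof.
have [mult chen _] := HX.
have [[s [t [sT tT X0]]]|nz] :=
    pselect (exists s t, [/\ s \in `[0, T], t \in `[0, T] & X s t (unit_forest d) = 0]).
  right=> u v uT vT h.
  have X1 : X u v (unit_forest d) = 0.
    rewrite (chen u s v) // /hstar cop0 big_seq1 /= (chen s t v) // /hstar cop0
      big_seq1 /=.
    by rewrite X0 mul0r mulr0.
  by rewrite -[h]msetD0 -mult // X1 mulr0.
left=> s t sT tT; have X0 : X s t (unit_forest d) != 0.
  by apply/eqP => X0; apply: nz; exists s, t.
by apply: (mulfI X0); rewrite mult // msetD0 mulr1.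
Qed.

Lemma rough_path_bigO tau : bigO_pow alpha t0 T (tree_size tau) (fun s u =>
  X s u (tree_forest tau)).
Proof.
have [_ _ /(_ tau)[C HC]] := HX.
exists `|C| => // s u ts su uT.
have su0 : 0 < u - s by rewrite subr_gt0.
have := HC s u (dom_mem ts (le_trans (ltW su) uT)) (dom_mem (le_trans ts (ltW su)) uT).
rewrite lt_eqF // (gtr0_norm su0) => /(_ isT);
  rewrite ler_pdivrMr ?powR_gt0 // powR_expn ?(ltW su0) //.
by move=> /le_trans; apply; rewrite ler_wpM2r ?powR_ge0 // ler_norm.
Qed.

(** Only h (x) 1 has an empty second factor: for empty [g] the sum in [cop_coef_cons] is void. *)
Lemma cop_coef_unit (a : hdual R d) h :
  character a -> cop_coef a h (unit_forest d) = a h.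
Proof.
move=> ca; move: {2}(size h) (erefl (size h)) => n; elim: n h => [|n IH] h hn.
  have -> : h = unit_forest d by apply/eqP; rewrite -size_mset_eq0 hn.
  by rewrite cop_coef0 // eqxx ca.1.
have [h0|[t th]] := mset_0Vmem h; first by rewrite h0 size_mset0 in hn.
rewrite -(msetB1K th) cop_coef_cons // enum_mset0 big_nil addr0 ca.2 IH //.
by move: hn; rewrite -{1}(msetB1K th) size_mset_cons => -[].
Qed.

Variables (y : R -> V) (Y : R -> forest d -> V).
Hypothesis HYc : controlled alpha X t0 T Y.
Hypothesis HYy : forall t, t \in `[t0, T] -> Y t (unit_forest d) = y t.
Hypothesis HYi : forall s t, t0 <= s -> s <= t -> t <= T ->
  exists2 I : 'I_d -> V,
    forall i, is_rough_integral alpha X i (fun r =>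
      comp_controlled alpha (f i) (Y r)) s t (I i) &
    y t - y s = \sum_(i < d) I i.
Hypothesis HYt : forall t, t \in `[t0, T] -> forall i h,
  (tree_size (bplus i h) <= N.-1)%N ->
  Y t (tree_forest (bplus i h)) = comp_controlled alpha (f i) (Y t) h.
Hypothesis HY0 : forall t, t \in `[t0, T] -> forall h,
  (forest_size h <= N.-1)%N -> h != unit_forest d ->
  (forall tau, h != tree_forest tau) -> Y t h = 0.

(** By [comp_controlled_trees] the coefficients of the solution obey the recursion [bcoef_bplus]. *)
Lemma solution_coef t tau : t \in `[t0, T] -> (tree_size tau <= N.-1)%N ->
  Y t (tree_forest tau) = bcoef f tau (y t).
Proof.
move=> tT; elim/tree_bplus_ind: tau => i h IH hN.
have hN' : (forest_size h <= N.-1)%N by move: hN; rewrite tree_size_bplus => /ltnW.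
have hp : (size h <= p)%N.
  by apply: leq_trans (forest_size_ge h) (leq_trans hN' (leq_trans (leq_pred _) Hp)).
rewrite HYt // comp_controlled_trees //; [|exact: cont_diff_level|exact: HY0].
rewrite HYy // (bcoef_bplus Cf) //; congr (_ *: totderiv (f i) _ _).
by apply/eq_in_map => s sh; apply: IH => //; apply: leq_trans (forest_size_mem sh) hN'.
Qed.

(** Here [bplus i h] may have N vertices, one more than in [solution_coef]; this is why the Riemann
    sums are partition sums of Xi^N. *)
Lemma comp_solution_coef t i h : t \in `[t0, T] -> (forest_size h <= N.-1)%N ->
  comp_controlled alpha (f i) (Y t) h = bcoef f (bplus i h) (y t).
Proof.
move=> tT hN'.
have hp : (size h <= p)%N.
  by apply: leq_trans (forest_size_ge h) (leq_trans hN' (leq_trans (leq_pred _) Hp)).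
rewrite comp_controlled_trees //; [|exact: cont_diff_level|exact: HY0].
rewrite HYy // (bcoef_bplus Cf) //; congr (_ *: totderiv (f i) _ _).
apply/eq_in_map => s sh; apply: solution_coef => //.
exact: leq_trans (forest_size_mem sh) hN'.
Qed.

Lemma riemann_sum_bseries s t P : t0 <= s -> itv_partition s t P -> t <= T ->
  \sum_(i < d) riemann_sum alpha X i (fun r => comp_controlled alpha (f i) (Y r)) s P =
  partition_sum (bseries f X y N) s P.
Proof.
move=> ts [sP /eqP lP] tT; rewrite /riemann_sum exchange_big /=.
apply: eq_big_seq => uv /(mem_partition sP)[su uv12 uvl].
have uT : uv.1 \in `[t0, T].
  by rewrite in_itv /= (le_trans ts su) (le_trans (ltW uv12)) // (le_trans uvl) // lP.
rewrite /bseries -{2}(prednK level_gt0) sum_trees_le; apply: eq_bigr => i _.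
rewrite fsbig_finite; last exact: finite_forest_le.
apply: eq_big_seq => h; rewrite -/(forests_le d N.-1) forests_leP => hN.
by rewrite comp_solution_coef.
Qed.

Lemma vanishing_solution : vanishing t0 T (fun s u => y u - y s - bseries f X y N s u).
Proof.
move=> s t ts st tT e e0; have [I HI yE] := HYi ts (ltW st) tT.
(* Dividing by d + 1 keeps the total of the d errors strictly below e and covers d = 0. *)
have e'0 : 0 < e / d.+1%:R by rewrite divr_gt0 // ltr0n.
have [dl Hdl] := @choice _ _ (fun i (delta : R) => 0 < delta /\
    forall P : seq R, itv_partition s t P -> mesh_lt delta s P ->
    `|riemann_sum alpha X i (fun r => comp_controlled alpha (f i) (Y r)) s P - I i| <
      e / d.+1%:R)
  (fun i => let: ex_intro2 dlt d0 H := HI i _ e'0 in ex_intro _ dlt (conj d0 H)).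
exists (\big[Num.min/1]_i dl i).
  by apply/bigmin_gtP; split=> // i _; case: (Hdl i).
move=> P Pst mP.
have sumE : partition_sum (fun s u => y u - y s) s P = y t - y s.
  by rewrite partition_sum_telescope; case: Pst => _ /eqP ->.
have -> : partition_sum (fun s u => y u - y s - bseries f X y N s u) s P =
    - \sum_(i < d) (riemann_sum alpha X i (fun r =>
      comp_controlled alpha (f i) (Y r)) s P - I i).
  by rewrite sumrB (riemann_sum_bseries ts Pst tT) -yE opprB -sumE /partition_sum sumrB.
rewrite normrN; apply: le_lt_trans (ler_norm_sum _ _ _) _.
apply: (@le_lt_trans _ _ (\sum_(i < d) (e / d.+1%:R))).
  apply: ler_sum => i _; apply/ltW/(Hdl i).2 => // uv /mP H.
  by apply: lt_le_trans H _; apply: bigmin_le_cond.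
rewrite sumr_const card_ord -[ltLHS]mulr_natr -mulrA gtr_pMr // mulrC ltr_pdivrMr
  ?ltr0n //.
by rewrite mul1r ltr_nat.
Qed.

(** For X = 0 the series vanishes, so the vanishing partition sums telescope to [y u - y s]. *)
Lemma constant_solution s u :
  (forall s t, s \in `[0, T] -> t \in `[0, T] -> forall h, X s t h = 0) ->
  t0 <= s -> s < u -> u <= T -> y u - y s - bseries f X y p s u = 0.
Proof.
move=> X0 ts su uT.
have Xi0 q r v : s <= r -> r < v -> v <= u -> bseries f X y q r v = 0.
  move=> sr rv vu; apply: big1 => t _; rewrite X0 ?scale0r //; apply: dom_mem; lra.
rewrite Xi0 // subr0; apply/eqP; rewrite -normr_le0; apply/ler_addgt0Pr => e e0.
have [dl dl0 Hdl] := vanishing_solution ts su uT e0.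
have [P Pst mP] := fine_partition dl0 su.
rewrite add0r; apply: le_trans (ltW (Hdl P Pst mP)).
have [sP /eqP lP] := Pst.
rewrite -lP -partition_sum_telescope le_eqVlt; apply/orP; left; apply/eqP; congr `|_|.
apply: eq_big_seq => uv /(mem_partition sP)[suv uv12 uvl].
by rewrite Xi0 ?subr0 // -lP.
Qed.

Lemma sum_tree_forests (U : nmodType) n (Phi : forest d -> U) :
  (forall h, (forest_size h <= n)%N -> h != unit_forest d ->
     (forall tau, h != tree_forest tau) -> Phi h = 0) ->
  \sum_(h <- forests_le d n) Phi h =
  Phi (unit_forest d) + \sum_(t <- trees_le d n) Phi (tree_forest t).
Proof.
move=> H0; pose isT (h : forest d) := h \in unit_forest d ::
  [seq tree_forest t | t <- enum_fset (trees_le d n)].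
rewrite (bigID isT) /= [X in _ + X]big1_seq ?addr0; last first.
  move=> h /andP[]; rewrite forests_leP /isT in_cons negb_or => /andP[h0 ht] hn;
    apply: (H0 h hn h0) => tau.
  apply/eqP => hE; move: ht => /mapP[]; exists tau => //.
  by rewrite trees_leP -forest_size_tree -hE.
rewrite -big_filter; transitivity (\sum_(h <- unit_forest d ::
  [seq tree_forest t | t <- enum_fset (trees_le d n)]) Phi h).
  apply: perm_big; apply: uniq_perm; rewrite ?filter_uniq ?fset_uniq //.
    rewrite /= map_inj_uniq ?fset_uniq ?andbT; last exact: tree_forest_inj.
    by apply/mapP => -[t _ /eqP]; rewrite eq_sym (negbTE (tree_forest_neq0 t)).
  move=> h; rewrite mem_filter -/(isT h) forests_leP andbC; case iTh: (isT h);
    rewrite ?andbF // andbT.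
  move: iTh; rewrite /isT in_cons => /predU1P[->|/mapP[t tn ->]];
    first by rewrite forest_size0.
  by rewrite forest_size_tree -trees_leP.
by rewrite big_cons big_map.
Qed.

Hypothesis X1 : forall s t, s \in `[0, T] -> t \in `[0, T] -> X s t (unit_forest d) = 1.

Lemma rough_path_character s u : t0 <= s -> s < u -> u <= T -> character (X s u).
Proof.
move=> ts su uT; have [mult _ _] := HX.
have sD := dom_mem ts (le_trans (ltW su) uT);
  have uD := dom_mem (le_trans ts (ltW su)) uT.
by split=> [|g h]; [rewrite X1|rewrite mult].
Qed.

Lemma hstar_dual_unit (a : hdual R d) h : character a ->
  hstar a (dual_forest R (unit_forest d)) h = a h.
Proof.
move=> ca; rewrite -[RHS](cop_coef_unit h ca) /hstar /cop_coef [RHS]big_mkcond.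
by apply: eq_bigr => q _; rewrite /dual_forest; case: eqP; rewrite ?mulr1 ?mulr0.
Qed.

Lemma solution_first_expansion :
  bigO_pow alpha t0 T N (fun s u => y u - y s - bseries f X y N.-1 s u).
Proof.
have [|C HC] := HYc.2 (unit_forest d); first by rewrite forest_size0.
exists `|C| => // s u ts su uT.
have tu := le_trans ts (ltW su); have sT := le_trans (ltW su) uT.
have sD : s \in `[t0, T] by rewrite in_itv /= ts.
have uD : u \in `[t0, T] by rewrite in_itv /= tu.
have su0 : 0 < u - s by rewrite subr_gt0.
have ca := rough_path_character ts su uT.
have pE : pairing N.-1 (hstar (X s u) (dual_forest R (unit_forest d))) (Y s) =
    y s + bseries f X y N.-1 s u.
  rewrite /pairing fsbig_finite; last exact: finite_forest_le.
  rewrite -/(forests_le d N.-1) sum_tree_forests => [|h hN h0 ht]; last first.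
    by rewrite (HY0 sD) ?scaler0.
  rewrite hstar_dual_unit // ca.1 scale1r HYy //; congr (_ + _).
  apply: eq_big_seq => t; rewrite trees_leP => tN.
  by rewrite hstar_dual_unit // solution_coef.
have := HC s u sD uD; rewrite pE HYy // forest_size0 subn0 (gtr0_norm su0) opprD addrA.
rewrite powR_expn ?(ltW su0) // [alpha * _]mulrC.
by move=> /le_trans; apply; rewrite ler_wpM2r ?powR_ge0 // ler_norm.
Qed.

(** Uniform bounds on [bcoef] along [y] presuppose a bound on [y]. Expanding from the fixed point
    [t0], where the coefficients are constants, avoids the circle. *)
Lemma solution_bounded : exists M : R, forall t, t0 <= t -> t <= T -> `|y t| <= M.
Proof.
have H1 : bigO_pow alpha t0 T 0 (fun s u => \sum_(t <- trees_le d N.-1)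
    X s u (tree_forest t) *: bcoef f t (y t0)).
  apply: bO_sum => t _ _; apply: (@bO_weak _ _ _ _ alpha_gt0 _ (tree_size t + 0)) => //.
  apply: bO_scale (rough_path_bigO t) _.
  exact: (@bO_cst _ _ _ _ _ _ `|bcoef f t (y t0)|).
have [C C0 HC] := bOD (bO_weak alpha_gt0 (leq0n _) solution_first_expansion) H1.
exists (`|y t0| + C) => t t0t tT.
have [->|tn0] := eqVneq t t0; first by rewrite lerDl.
have t0t' : t0 < t by rewrite lt_neqAle eq_sym tn0.
have := HC t0 t (lexx _) t0t' tT; rewrite expr0 mulr1 /bseries subrK => H.
by rewrite -[y t](subrK (y t0)) addrC; apply: le_trans (ler_normD _ _) _;
  rewrite lerD2l.
Qed.

Lemma solution_expansion : bigO_pow alpha t0 T p.+1 (fun s u =>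
  y u - y s - bseries f X y p s u).
Proof.
have [M yM] := solution_bounded.
have chen s u t : t0 <= s -> s < u -> u < t -> t <= T -> X s t = hstar (X s u) (X u t).
  move=> ts su ut tT; have [_ ch _] := HX; apply: ch; apply: dom_mem; rewrite ?ts //.
  - by apply: le_trans tT; apply: ltW; apply: lt_trans ut.
  - by apply: le_trans ts (ltW su).
  - by apply: le_trans (ltW ut) tT.
  - by apply: le_trans ts (ltW (lt_trans su ut)).
have NN := prednK level_gt0.
(* The controlled path only carries trees with at most N - 1 vertices; those with N vertices
   contribute order N, the order of its error. *)
have base : bigO_pow alpha t0 T N (fun s u => y u - y s - bseries f X y N s u).
  have := bO_bseries_diff alpha_gt0 Cf rough_path_bigO yM (leq_pred N) Hp.
  rewrite NN => D; apply: bO_eq (bOB solution_first_expansion D) => s u _ _ _.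
  by rewrite opprB subrKA.
have ylip : bigO_pow alpha t0 T 1 (fun s u => y u - y s).
  have := bOD (bO_weak alpha_gt0 level_gt0 base)
    (bO_bseries alpha_gt0 Cf rough_path_bigO yM Hp).
  by apply: bO_eq => s u _ _ _; rewrite subrK.
exact: (local_expansion alpha_gt0 Cf rough_path_character rough_path_bigO chen yM ylip
  level_gt0 level_large base vanishing_solution Hp (leqnn p)).
Qed.

End Solutions.

Theorem theorem10 (R : realType) (d m : nat) (alpha T t0 : R) (p : nat)
    (X : R -> R -> hdual R d) (f : 'I_d -> 'rV[R]_m -> 'rV[R]_m)
    (y0 : 'rV[R]_m) (y : R -> 'rV[R]_m)
    (alpha_gt0 : 0 < alpha) (alpha_le1 : alpha <= 1)
    (HX : branched_rough_path alpha T X)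
    (Hp : (Num.truncn alpha^-1 <= p)%N)
    (Hf : forall i, cont_diff p (f i))
    (t0_ge0 : 0 <= t0) (t0_ltT : t0 < T)
    (Hy : rde_solution alpha T X f t0 y0 y) :
  (fun h : R => y (t0 + h)) =
    (fun h : R => y0 +
       \sum_(tau \in [set tau : tree d | (tree_size tau <= p)%N])
         ((symfactor tau)%:R^-1 * X t0 (t0 + h) (tree_forest tau)) *:
           elemdiff f tau y0)
    +O_ (0^'+) (fun h : R => h `^ (p.+1%:R * alpha)).
Proof.
have [yt0 [Y [HYc HYy HYi HYt HY0]]] := Hy.
have [C C0 HC] : bigO_pow alpha t0 T p.+1 (fun s u => y u - y s - bseries f X y p s u).
  have [X1|X0] := unit_dichotomy HX.
    exact: (solution_expansion alpha_gt0 alpha_le1 HX Hp Hf t0_ge0 HYc HYy HYi HYt HY0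
      X1).
  apply: bO_eq (bO0 alpha t0 T _ p.+1) => s u ts su uT.
  by rewrite (constant_solution alpha_gt0 alpha_le1 Hp Hf t0_ge0 HYy HYi HYt HY0 X0).
(* The expansion holds for all s < u; it is now read at s = t0 and u = t0 + h with 0 < h < T -
   t0. *)
apply/eqaddOP; exists C; split; first exact: num_real.
move=> K CK; have K0 : 0 < K by apply: le_lt_trans CK.
near=> h.
have h0 : 0 < h by near: h; apply: nbhs_right_gt.
have hT : h < T - t0 by near: h; apply: nbhs_right_lt; rewrite subr_gt0.
rewrite !fctE fsbig_finite; last exact: finite_tree_le.
rewrite -/(trees_le d p).
have := HC t0 (t0 + h) (lexx _); rewrite yt0 ltrDl h0 (addrAC t0 h) subrr add0r.
have -> : t0 + h <= T by lra.
move=> /(_ isT isT) H.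
have -> : \sum_(tau <- trees_le d p)
    ((symfactor tau)%:R^-1 * X t0 (t0 + h) (tree_forest tau)) *: elemdiff f tau y0 =
    bseries f X y p t0 (t0 + h).
  apply: eq_bigr => tau _; rewrite /bcoef yt0 scalerA; congr (_ *: _); exact: mulrC.
rewrite opprD addrA; apply: le_trans H _.
rewrite (ger0_norm (powR_ge0 _ _)) powR_expn ?(ltW h0) //.
by rewrite [p.+1%:R * _]mulrC ler_wpM2r ?powR_ge0 // ltW.
Unshelve. all: by end_near.
Qed.
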